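(* Let $K$ be a field and let $A$ be a finite dimensional $K$-algebra. Then for every $c$-vector $\mathsf{c}$ of $A$ there exist a brick $B_{\mathsf{c}}$ in the module category $\mathrm{mod}\,A$ and a non-zero integer $m_{\mathsf{c}}$ such that $$D_A[B_{\mathsf{c}}]=m_{\mathsf{c}}\,\mathsf{c}.$$
   Context: $K$ is an arbitrary field (not necessarily algebraically closed), and $\mathrm{mod}\,A$ is the category of finitely generated right $A$-modules. ''Module'' means object of $\mathrm{mod}\,A$. Let $\{S(1),\dots,S(n)\}$ be a complete family of representatives of the isomorphism classes of simple $A$-modules, and let $P(i)$ be the projective cover of $S(i)$. The Grothendieck group $K_0(A)$ is free abelian with basis $[S(1)],\dots,[S(n)]$, and is identified with $\mathbb{Z}^n\subset\mathbb{R}^n$; thus for a module $N$, $[N]$ is the column vector whose $i$-th entry is the multiplicity of $S(i)$ as a composition factor of $N$. Put $\delta_i=\dim_K\mathrm{End}_A(S(i))$ and let $D_A$ be the $n\times n$ diagonal matrix $\mathrm{diag}(\delta_1,\dots,\delta_n)$. A brick is a module $B$ whose endomorphism algebra $\mathrm{End}_A(B)$ is a division ring (in particular $B\neq0$). Nakayama functor: $\nu=\mathrm{Hom}_K(\mathrm{Hom}_A(-,A),K)$. Auslander-Reiten translation: if $P_1\to P_0\to M\to 0$ is the minimal projective presentation of $M$, then $\tau M$ is the kernel of $\nu P_1\to\nu P_0$. A module $M$ is $\tau$-rigid if $\mathrm{Hom}_A(M,\tau M)=0$. A pair $(M,P)$ with $M$ a module and $P$ a projective module, both basic (no two distinct indecomposable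 direct summands in a decomposition of $M$, respectively of $P$, are isomorphic), is a $\tau$-rigid pair if $M$ is $\tau$-rigid and $\mathrm{Hom}_A(P,M)=0$. A $\tau$-rigid pair $(M,P)$ is a $\tau$-tilting pair if the number of pairwise non-isomorphic indecomposable direct summands of $M\oplus P$ is equal to $n$. $g$-vectors: if $P_1\to P_0\to M\to 0$ is the minimal projective presentation of $M$, with $P_0=\bigoplus_{i=1}^n P(i)^{a_i}$ and $P_1=\bigoplus_{i=1}^n P(i)^{a_i'}$, then the $g$-vector of $M$ is $g^M=(a_1-a_1',\dots,a_n-a_n')\in\mathbb{Z}^n$. $c$-vectors: let $(M,P)$ be a $\tau$-tilting pair with decompositions into indecomposables $M=\bigoplus_{i=1}^k M_i$ and $P=\bigoplus_{j=k+1}^n P_j$. It is known that $\{g^{M_1},\dots,g^{M_k},-g^{P_{k+1}},\dots,-g^{P_n}\}$ is a basis of $\mathbb{Z}^n$. Let $G_{(M,P)}$ be the $n\times n$ matrix with columns $g^{M_1},\dots,g^{M_k},-g^{P_{k+1}},\dots,-g^{P_n}$, and let $C_{(M,P)}=(G_{(M,P)}^{-1})^{T}$. A $c$-vector of $A$ is a column of $C_{(M,P)}$ for some $\tau$-tilting pair $(M,P)$. *)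

(* Defs.v *)
From HB Require Import structures.
From mathcomp Require Import all_boot all_order all_algebra all_field.

Set Implicit Arguments.
Unset Strict Implicit.
Unset Printing Implicit Defensive.

Import GRing.Theory.
Local Open Scope ring_scope.

Lemma linfun_linearE (K : fieldType) (V W : vectType K) (f : V -> W) :
  linear f -> linfun f =1 f.
Proof.
move=> lf; pose mx := GRing.isLinear.Build K V W _ f lf.
pose ff : {linear V -> W} := HB.pack f mx.
exact: (lfunE ff).
Qed.

(* Finitely generated right A-modules, that is, right A-modules of finite
   dimension over K: [ract a] is the K-endomorphism x |-> x a, whence the order
   of the factors in [ractM]. *)
Record rmodule (K : fieldType) (A : falgType K) := RModule {
  rcarrier :> vectType K;
  ract : A -> 'End(rcarrier);
  ract_linear : linear ract;
  ract1 : ract 1 = \1%VF;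
  ractM : forall a b, ract (a * b) = (ract b \o ract a)%VF
}.

Section Modules.

Variables (K : fieldType) (A : falgType K).
Implicit Types L M N P Q T X Y : rmodule A.

(* The space Hom_A(M, N) inside Hom_K(M, N); see HomAP. *)
Definition HomA M N : {vspace 'Hom(M, N)} :=
  lker (linfun (fun f : 'Hom(M, N) =>
    linfun (fun a : A => (f \o ract M a)%VF - (ract N a \o f)%VF))).

Lemma HomAP M N (f : 'Hom(M, N)) :
  reflect (forall a x, f (ract M a x) = ract N a (f x)) (f \in HomA M N).
Proof.
have lin1 (g : 'Hom(M, N)) :
    linear (fun a : A => (g \o ract M a)%VF - (ract N a \o g)%VF).
  move=> k a b; apply/lfunP=> x; rewrite !ract_linear !lfun_simp /= linearP.
  by rewrite scalerBr opprD addrACA.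
have lin2 : linear (fun g : 'Hom(M, N) =>
    linfun (fun a : A => (g \o ract M a)%VF - (ract N a \o g)%VF)).
  move=> k g h; apply/lfunP=> a.
  rewrite add_lfunE scale_lfunE !linfun_linearE //.
  apply/lfunP=> x; rewrite !lfun_simp /= linearP.
  by rewrite scalerBr opprD addrACA.
rewrite memv_ker linfun_linearE //; apply: (iffP eqP) => [f0 a x | fA].
  have := congr1 (fun F : 'Hom(A, 'Hom(M, N)) => F a x) f0.
  by rewrite linfun_linearE // !lfun_simp /= => /subr0_eq.
apply/lfunP=> a; rewrite linfun_linearE //; apply/lfunP=> x.
by rewrite !lfun_simp /= fA subrr.
Qed.

Definition injectiveA M N (f : 'Hom(M, N)) : Prop := lker f = 0%VS.
Definition surjectiveA M N (f : 'Hom(M, N)) : Prop := limg f = fullv.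

Definition isoA M N : Prop :=
  exists f g, [/\ f \in HomA M N, g \in HomA N M,
                  (g \o f)%VF = \1%VF & (f \o g)%VF = \1%VF].

Definition is_submod M (U : {vspace M}) : Prop :=
  forall a x, x \in U -> ract M a x \in U.

Definition nonzero_mod M : Prop := fullv != 0%VS :> {vspace M}.

Definition simple_mod M : Prop :=
  nonzero_mod M /\
  forall U : {vspace M}, is_submod U -> U = 0%VS \/ U = fullv.

Definition brick M : Prop :=
  nonzero_mod M /\
  forall f, f \in HomA M M -> f != 0 ->
  exists g, [/\ g \in HomA M M, (g \o f)%VF = \1%VF & (f \o g)%VF = \1%VF].

Definition indecomposable M : Prop :=
  nonzero_mod M /\
  forall U V : {vspace M}, is_submod U -> is_submod V ->
    (U + V)%VS = fullv -> (U :&: V)%VS = 0%VS -> U = 0%VS \/ V = 0%VS.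

Definition projective_mod P : Prop :=
  forall M N (p : 'Hom(M, N)) (f : 'Hom(P, N)),
    p \in HomA M N -> surjectiveA p -> f \in HomA P N ->
  exists2 h, h \in HomA P M & (p \o h)%VF = f.

Definition superfluous M (U : {vspace M}) : Prop :=
  forall V : {vspace M}, is_submod V -> (V + U)%VS = fullv -> V = fullv.

(* Corestricted to the submodule U of M, p : P -> M is a projective cover. *)
Definition is_projective_cover P M (p : 'Hom(P, M)) (U : {vspace M}) : Prop :=
  [/\ projective_mod P, p \in HomA P M, limg p = U & superfluous (lker p)].

Definition minimal_presentation P1 P0 M
    (d1 : 'Hom(P1, P0)) (d0 : 'Hom(P0, M)) : Prop :=
  is_projective_cover d0 fullv /\ is_projective_cover d1 (lker d0).

Definition is_direct_sum M (I : finType) (X : I -> rmodule A) : Prop :=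
  exists (inj : forall i, 'Hom(X i, M)) (prj : forall i, 'Hom(M, X i)),
  [/\ forall i, inj i \in HomA (X i) M /\ prj i \in HomA M (X i),
      forall i, (prj i \o inj i)%VF = \1%VF,
      forall i j, i != j -> (prj j \o inj i)%VF = 0 &
      \sum_i (inj i \o prj i)%VF = \1%VF].

Definition indecomposable_decomposition M (I : finType) (X : I -> rmodule A) :=
  is_direct_sum M X /\ forall i, indecomposable (X i).

Definition basic M : Prop :=
  forall (k : nat) (X : 'I_k -> rmodule A),
    indecomposable_decomposition M X -> forall i j, isoA (X i) (X j) -> i = j.

Section DirectSum.

Variables M N : rmodule A.

Definition dsum_act (a : A) : 'End((M * N)%type) :=
  linfun (fun x : M * N => (ract M a x.1, ract N a x.2)).

Lemma dsum_actE a x : dsum_act a x = (ract M a x.1, ract N a x.2).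
Proof.
by apply: linfun_linearE => k [x1 x2] [y1 y2]; congr pair; rewrite /= linearP.
Qed.

Lemma dsum_act_linear : linear dsum_act.
Proof.
move=> k a b; apply/lfunP=> -[x y]; rewrite !lfun_simp /= !dsum_actE /=.
by rewrite !ract_linear !lfun_simp.
Qed.

Lemma dsum_act1 : dsum_act 1 = \1%VF.
Proof. by apply/lfunP=> -[x y]; rewrite dsum_actE /= !ract1 !id_lfunE. Qed.

Lemma dsum_actM a b : dsum_act (a * b) = (dsum_act b \o dsum_act a)%VF.
Proof.
by apply/lfunP=> x; rewrite comp_lfunE !dsum_actE /= !ractM !comp_lfunE.
Qed.

Definition dsum : rmodule A := RModule dsum_act_linear dsum_act1 dsum_actM.

End DirectSum.

Definition direct_summand X M : Prop := exists Y, isoA M (dsum X Y).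

(* M has exactly k indecomposable direct summands up to isomorphism. *)
Definition nb_indecomposable_summands M (k : nat) : Prop :=
  exists X : 'I_k -> rmodule A,
  [/\ forall i, indecomposable (X i) /\ direct_summand (X i) M,
      forall i j, isoA (X i) (X j) -> i = j &
      forall Y, indecomposable Y -> direct_summand Y M ->
        exists i, isoA Y (X i)].

Lemma regular_act1 : amulr (1 : A) = \1%VF.
Proof. by apply/lfunP=> x; rewrite lfunE /= mulr1 id_lfunE. Qed.

Lemma regular_actM (a b : A) : amulr (a * b) = (amulr b \o amulr a)%VF.
Proof. by apply/lfunP=> x; rewrite comp_lfunE !lfunE /= mulrA. Qed.

Definition regular_mod : rmodule A :=
  @RModule K A A (@amulr K A) (@amulr_is_linear K A) regular_act1 regular_actM.

Section Nakayama.

Variable M : rmodule A.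

(* The left A-module Hom_A(M, A), with (a h)(x) = a h(x). *)
Definition dualA : vectType K := subvs_of (HomA M regular_mod).

Lemma amull_comp_HomA a (h : 'Hom(M, A)) :
  h \in HomA M regular_mod -> (amull a \o h)%VF \in HomA M regular_mod.
Proof.
move=> /HomAP hA; apply/HomAP=> b x.
by rewrite !comp_lfunE hA /= !lfunE /= mulrA.
Qed.

Definition dualA_act (a : A) : 'End(dualA) :=
  linfun (fun h : dualA => vsproj (HomA M regular_mod) (amull a \o vsval h)%VF).

Lemma dualA_actE a h : vsval (dualA_act a h) = (amull a \o vsval h)%VF.
Proof.
rewrite linfun_linearE ?vsprojK ?amull_comp_HomA ?subvsP // => k u v.
by rewrite linearP comp_lfunDr -comp_lfunZr linearP.
Qed.

Definition nakayama_act (a : A) : 'End('Hom(dualA, K^o)) :=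
  linfun (fun phi : 'Hom(dualA, K^o) => (phi \o dualA_act a)%VF).

Lemma nakayama_actE a phi : nakayama_act a phi = (phi \o dualA_act a)%VF.
Proof.
by apply: linfun_linearE => k u v; rewrite comp_lfunDl -comp_lfunZl.
Qed.

Lemma nakayama_act_linear : linear nakayama_act.
Proof.
move=> k a b; apply/lfunP=> phi; rewrite add_lfunE scale_lfunE !nakayama_actE.
apply/lfunP=> h; rewrite add_lfunE scale_lfunE !comp_lfunE.
have ->: dualA_act (k *: a + b) h = k *: dualA_act a h + dualA_act b h.
  apply: val_inj; rewrite /= !dualA_actE.
  by rewrite linearP /= comp_lfunDl -comp_lfunZl.
exact: linearP.
Qed.

Lemma nakayama_act1 : nakayama_act 1 = \1%VF.
Proof.
apply/lfunP=> phi; rewrite nakayama_actE id_lfunE; apply/lfunP=> h.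
rewrite comp_lfunE; congr (phi _); apply: val_inj; rewrite /= dualA_actE.
by rewrite amull1 comp_lfun1l.
Qed.

Lemma nakayama_actM a b :
  nakayama_act (a * b) = (nakayama_act b \o nakayama_act a)%VF.
Proof.
apply/lfunP=> phi; rewrite comp_lfunE !nakayama_actE; apply/lfunP=> h.
rewrite !comp_lfunE; congr (phi _); apply: val_inj; rewrite /= !dualA_actE.
by rewrite comp_lfunA; congr comp_lfun; apply/lfunP=> x;
   rewrite comp_lfunE !lfunE /= mulrA.
Qed.

Definition nakayama : rmodule A :=
  RModule nakayama_act_linear nakayama_act1 nakayama_actM.

End Nakayama.

(* Hom_A(f, A); it is h |-> h o f when f is A-linear, see dualA_homE. *)
Definition dualA_hom M N (f : 'Hom(M, N)) : 'Hom(dualA N, dualA M) :=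
  linfun (fun h : dualA N => vsproj (HomA M regular_mod) (vsval h \o f)%VF).

Lemma dualA_homE M N (f : 'Hom(M, N)) h :
  f \in HomA M N -> vsval (dualA_hom f h) = (vsval h \o f)%VF.
Proof.
move=> /HomAP fA; rewrite linfun_linearE ?vsprojK // => [|k u v].
  have /HomAP hA := subvsP h.
  by apply/HomAP=> a x; rewrite !comp_lfunE fA hA.
by rewrite linearP comp_lfunDl -comp_lfunZl linearP.
Qed.

Definition nakayama_hom M N (f : 'Hom(M, N)) :
    'Hom(nakayama M, nakayama N) :=
  linfun (fun phi : 'Hom(dualA M, K^o) => (phi \o dualA_hom f)%VF).

Lemma nakayama_homE M N (f : 'Hom(M, N)) (phi : 'Hom(dualA M, K^o)) :
  nakayama_hom f phi = (phi \o dualA_hom f)%VF.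
Proof.
by apply: linfun_linearE => k u v; rewrite comp_lfunDl -comp_lfunZl.
Qed.

(* T is (isomorphic to) tau M: a kernel of nu d1 : nu P1 -> nu P0, where d1 comes
   from a minimal projective presentation of M. *)
Definition is_tau M T : Prop :=
  exists P1 P0 (d1 : 'Hom(P1, P0)) (d0 : 'Hom(P0, M))
         (i : 'Hom(T, nakayama P1)),
  [/\ minimal_presentation d1 d0, i \in HomA T (nakayama P1), injectiveA i &
      limg i = lker (nakayama_hom d1)].

Definition tau_rigid M : Prop :=
  exists2 T, is_tau M T & HomA M T = 0%VS.

Definition tau_rigid_pair M P : Prop :=
  [/\ projective_mod P, basic M, basic P, tau_rigid M & HomA P M = 0%VS].

Definition tau_tilting_pair (n : nat) M P : Prop :=
  tau_rigid_pair M P /\ nb_indecomposable_summands (dsum M P) n.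

Section SimpleFamily.

Variables (n : nat) (S P : 'I_n -> rmodule A).

Definition complete_simples : Prop :=
  [/\ forall i, simple_mod (S i),
      forall i j, isoA (S i) (S j) -> i = j &
      forall M, simple_mod M -> exists i, isoA M (S i)].

Definition projective_covers : Prop :=
  forall i, exists p : 'Hom(P i, S i), is_projective_cover p fullv.

Definition D_mx : 'M[int]_n := diag_mx (\row_i (\dim (HomA (S i) (S i)))%:Z).

(* [K0_class M v] says that M has a composition series in which, for each i,
   exactly v_i factors are isomorphic to S(i): in the second constructor L is the
   last proper term of the series, and S(i) the top factor. *)
Inductive K0_class : rmodule A -> 'cV[int]_n -> Prop :=
| K0_class0 M : ~ nonzero_mod M -> K0_class M 0
| K0_classS L M i v (f : 'Hom(L, M)) (g : 'Hom(M, S i)) :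
    f \in HomA L M -> g \in HomA M (S i) ->
    injectiveA f -> limg f = lker g -> surjectiveA g ->
    K0_class L v -> K0_class M (v + delta_mx i 0).

(* Q is isomorphic to the direct sum of the P(i)^(a i). *)
Definition has_multiplicities Q (a : 'I_n -> nat) : Prop :=
  is_direct_sum Q (fun x : {i : 'I_n & 'I_(a i)} => P (tag x)).

Definition is_g_vector M (g : 'cV[int]_n) : Prop :=
  exists P1 P0 (d1 : 'Hom(P1, P0)) (d0 : 'Hom(P0, M)) (a a' : 'I_n -> nat),
  [/\ minimal_presentation d1 d0, has_multiplicities P0 a,
      has_multiplicities P1 a' & g = \col_i ((a i)%:Z - (a' i)%:Z)].

(* G is the matrix G_(M,Q) attached to the decompositions of M as the direct sum
   of the X j with j < k and of Q as that of the X j with k <= j. *)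
Definition is_G_matrix M Q (G : 'M[int]_n) : Prop :=
  exists (k : nat) (X : 'I_n -> rmodule A),
  [/\ (k <= n)%N,
      indecomposable_decomposition M (fun j : {j : 'I_n | (j < k)%N} => X (val j)),
      indecomposable_decomposition Q (fun j : {j : 'I_n | (k <= j)%N} => X (val j)) &
      forall j, is_g_vector (X j) (if (j < k)%N then col j G else - col j G)].

(* C^T *m G = 1%:M says that C is the transpose of the inverse of G. *)
Definition c_vector (c : 'cV[int]_n) : Prop :=
  exists M Q (G C : 'M[int]_n) (j : 'I_n),
  [/\ tau_tilting_pair n M Q, is_G_matrix M Q G, C^T *m G = 1%:M &
      c = col j C].

End SimpleFamily.

End Modules.

(* Main.v *)
Require Import Defs.
From mathcomp Require Import all_boot all_order all_algebra all_field.
From HB Require Import structures.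
From Stdlib Require Import Classical.

(* Let X_i be the minimal presentation of M_i, or P_i -> 0, for the summands of
   the tau-tilting pair other than the j-th, and let W be the category of modules
   N with Hom(X_i, N) = Hom(X_i, N[1]) = 0 for all i <> j.  Images of endomorphisms
   of objects of W are in W, hence a nonzero object B of W of minimal dimension is
   a brick.  As g^{X_i} . D_A[N] = dim Hom(X_i, N) - dim Hom(X_i, N[1]), the vector
   D_A[B] is orthogonal to all columns of G but the j-th, which makes it a nonzero
   multiple of the j-th column of C.

   That W is nonzero is shown by silting theory.  If W = 0, a left approximation
   P -> X'' of a projective P by sums of the X_i has a cone Y, and a right
   approximation of Y by such a sum is split up to homotopy; by Krull-Schmidt the
   X_i then generate the class of P in K_0.  But the pairing with c vanishes on all
   the g^{X_i} and not on all projectives.  In order to avoid Krull-Schmidt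
   decompositions, this pairing is extended to an additive function mu on all
   modules, and one propagates the property that mu agrees on the two terms of
   every direct summand of a complex. *)

Set Implicit Arguments.
Unset Strict Implicit.
Unset Printing Implicit Defensive.

Import Order.TTheory GRing.Theory Num.Theory.
Local Open Scope ring_scope.

(** * Spaces of A-linear maps and their composition *)

(** A separate name for the subspace type lets these spaces carry a coercion to functions and, on
    endomorphisms, the ring structure given by composition. *)
Definition homA (K : fieldType) (A : falgType K) (M N : rmodule A) : Type :=
  subvs_of (HomA M N).

HB.instance Definition _ K A (M N : rmodule A) :=
  Vector.copy (@homA K A M N) (subvs_of (HomA M N)).

Definition happ K A (M N : rmodule A) (f : @homA K A M N) : M -> N := vsval f.
Coercion happ : homA >-> Funclass.

Section Cat.
Variables (K : fieldType) (A : falgType K).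
Implicit Types L M N P Q T : rmodule A.

Lemma happ_lin M N (f : homA M N) : linear f.
Proof. exact: linearP. Qed.

HB.instance Definition _ M N (f : homA M N) :=
  GRing.isLinear.Build K M N _ (f : M -> N) (@happ_lin M N f).

Lemma happA M N (f : homA M N) a x : f (ract M a x) = ract N a (f x).
Proof. by have /HomAP := subvsP f; apply. Qed.

Lemma hom_ext M N (f g : homA M N) : f =1 g -> f = g.
Proof. by move=> fg; apply/val_inj/lfunP. Qed.

Definition mkhom M N (f : 'Hom(M, N)) (fA : f \in HomA M N) : homA M N :=
  vsproj (HomA M N) f.

Lemma mkhomE M N (f : 'Hom(M, N)) (fA : f \in HomA M N) : mkhom fA =1 f.
Proof. by move=> x; rewrite /happ vsprojK. Qed.

Lemma hom_of M N (f : M -> N) :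
    linear f -> (forall a x, f (ract M a x) = ract N a (f x)) ->
  {g : homA M N | g =1 f}.
Proof.
move=> lf fA.
have fh : linfun f \in HomA M N.
  by apply/HomAP=> a x; rewrite !linfun_linearE.
by exists (mkhom fh) => x; rewrite mkhomE linfun_linearE.
Qed.

Definition hcomp L M N (f : homA M N) (g : homA L M) : homA L N.
Proof.
apply: sval (@hom_of L N (fun x => f (g x)) _ _).
  by move=> k x y; rewrite !linearP.
by move=> a x; rewrite !happA.
Defined.

Lemma hcompE L M N (f : homA M N) (g : homA L M) x : hcomp f g x = f (g x).
Proof. by rewrite /hcomp; case: hom_of. Qed.

Definition hid M : homA M M.
Proof. by apply: sval (@hom_of M M id _ _). Defined.

Lemma hidE M x : hid M x = x.
Proof. by rewrite /hid; case: hom_of. Qed.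

Lemma haddE M N (f g : homA M N) x : happ (f + g) x = f x + g x.
Proof. by rewrite /happ raddfD add_lfunE. Qed.
Lemma hoppE M N (f : homA M N) x : happ (- f) x = - f x.
Proof. by rewrite /happ raddfN opp_lfunE. Qed.
Lemma hscaleE M N k (f : homA M N) x : happ (k *: f) x = k *: f x.
Proof. by rewrite /happ linearZ scale_lfunE. Qed.
Lemma hzeroE M N x : happ (0 : homA M N) x = 0.
Proof. by rewrite /happ raddf0 zero_lfunE. Qed.
Definition hE := (hcompE, hidE, haddE, hoppE, hscaleE, hzeroE).

Notation "f \oA g" := (hcomp f g) (at level 40, left associativity).

Lemma hcompA L M N P (f : homA N P) (g : homA M N) (h : homA L M) :
  f \oA (g \oA h) = f \oA g \oA h.
Proof. by apply: hom_ext => x; rewrite !hE. Qed.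
Lemma hcomp1l M N (f : homA M N) : hid N \oA f = f.
Proof. by apply: hom_ext => x; rewrite !hE. Qed.
Lemma hcomp1r M N (f : homA M N) : f \oA hid M = f.
Proof. by apply: hom_ext => x; rewrite !hE. Qed.
Lemma hcompDl L M N (f g : homA M N) (h : homA L M) :
  (f + g) \oA h = f \oA h + g \oA h.
Proof. by apply: hom_ext => x; rewrite !hE. Qed.
Lemma hcompDr L M N (f : homA M N) (g h : homA L M) :
  f \oA (g + h) = f \oA g + f \oA h.
Proof. by apply: hom_ext => x; rewrite !hE raddfD. Qed.
Lemma hcompNl L M N (f : homA M N) (h : homA L M) : (- f) \oA h = - (f \oA h).
Proof. by apply: hom_ext => x; rewrite !hE. Qed.
Lemma hcompNr L M N (f : homA M N) (h : homA L M) : f \oA (- h) = - (f \oA h).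
Proof. by apply: hom_ext => x; rewrite !hE raddfN. Qed.
Lemma hcompBl L M N (f g : homA M N) (h : homA L M) :
  (f - g) \oA h = f \oA h - g \oA h.
Proof. by rewrite hcompDl hcompNl. Qed.
Lemma hcompBr L M N (f : homA M N) (g h : homA L M) :
  f \oA (g - h) = f \oA g - f \oA h.
Proof. by rewrite hcompDr hcompNr. Qed.
Lemma hcompZl L M N k (f : homA M N) (h : homA L M) :
  (k *: f) \oA h = k *: (f \oA h).
Proof. by apply: hom_ext => x; rewrite !hE. Qed.
Lemma hcompZr L M N k (f : homA M N) (h : homA L M) :
  f \oA (k *: h) = k *: (f \oA h).
Proof. by apply: hom_ext => x; rewrite !hE linearZ. Qed.
Lemma hcomp0l L M N (h : homA L M) : (0 : homA M N) \oA h = 0.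
Proof. by apply: hom_ext => x; rewrite !hE. Qed.
Lemma hcomp0r L M N (f : homA M N) : f \oA (0 : homA L M) = 0.
Proof. by apply: hom_ext => x; rewrite !hE raddf0. Qed.
Lemma hcomp_suml L M N (I : Type) (r : seq I) (Q : pred I) (f : I -> homA M N) (h : homA L M) :
  (\sum_(i <- r | Q i) f i) \oA h = \sum_(i <- r | Q i) f i \oA h.
Proof. by apply: (big_morph (fun f => f \oA h)) => [x y|]; rewrite ?hcompDl ?hcomp0l. Qed.
Lemma hcomp_sumr L M N (I : Type) (r : seq I) (Q : pred I) (f : homA M N) (h : I -> homA L M) :
  f \oA (\sum_(i <- r | Q i) h i) = \sum_(i <- r | Q i) f \oA h i.
Proof. by apply: (big_morph (fun h => f \oA h)) => [x y|]; rewrite ?hcompDr ?hcomp0r. Qed.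
Definition hDE := (hcompDl, hcompDr, hcompNl, hcompNr, hcomp0l, hcomp0r, hcompZl, hcompZr).
End Cat.

Notation "f \oA g" := (hcomp f g) (at level 40, left associativity).

(** * Submodules, quotients, lifting through projectives, kernels and direct sums *)

Section Constructions.
Variables (K : fieldType) (A : falgType K).
Implicit Types L M N P Q T : rmodule A.

Definition hsurj M N (f : homA M N) := forall y, exists x, f x = y.
Definition hinj M N (f : homA M N) := forall x, f x = 0 -> x = 0.

Lemma hsurjP M N (f : homA M N) : hsurj f <-> surjectiveA (vsval f).
Proof.
split=> [fs | fs y].
  apply/eqP; rewrite eqEsubv subvf; apply/subvP=> y _.
  by have [x <-] := fs y; apply: memv_img (memvf x).
have: y \in limg (vsval f) by rewrite fs memvf.
by case/memv_imgP=> x _ ->; exists x.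
Qed.

Lemma hinjP M N (f : homA M N) : hinj f <-> injectiveA (vsval f).
Proof.
split=> [fi | fi x /eqP]; last by rewrite -memv_ker fi memv0 => /eqP.
apply/eqP; rewrite -subv0; apply/subvP=> x; rewrite memv_ker => /eqP /fi ->.
exact: mem0v.
Qed.

Lemma hinj_eq M N (f : homA M N) x y : hinj f -> f x = f y -> x = y.
Proof. by move=> fi fxy; apply/subr0_eq/fi; rewrite raddfB /= fxy subrr. Qed.

Lemma hinj_mono L M N (f : homA M N) (g h : homA L M) :
  hinj f -> f \oA g = f \oA h -> g = h.
Proof.
move=> fi fgh; apply: hom_ext => x; apply: (hinj_eq fi).
by rewrite -!hcompE fgh.
Qed.

Lemma hker_submod M N (f : homA M N) : is_submod (lker (vsval f)).
Proof.
move=> a x; rewrite !memv_ker => /eqP fx.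
by rewrite -/(happ f) happA /happ fx linear0.
Qed.

Lemma himg_submod M N (f : homA M N) : is_submod (limg (vsval f)).
Proof.
move=> a _ /memv_imgP[x _ ->]; rewrite -/(happ f x) -happA.
exact: memv_img (memvf _).
Qed.

Section Submodule.
Variables (M : rmodule A) (U : {vspace M}) (Us : is_submod U).

Definition subm_act (a : A) : 'End(subvs_of U) :=
  linfun (fun u => vsproj U (ract M a (vsval u))).

Lemma subm_actE a u : vsval (subm_act a u) = ract M a (vsval u).
Proof.
rewrite linfun_linearE ?vsprojK ?Us ?subvsP // => k x y.
by rewrite !linearP.
Qed.

Lemma subm_act_linear : linear subm_act.
Proof.
move=> k a b; apply/lfunP=> u; apply: val_inj => /=.
rewrite add_lfunE scale_lfunE /= subm_actE.
by rewrite ract_linear !lfun_simp -!subm_actE.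
Qed.

Lemma subm_act1 : subm_act 1 = \1%VF.
Proof.
by apply/lfunP=> u; apply: val_inj; rewrite /= subm_actE ract1 !id_lfunE.
Qed.

Lemma subm_actM a b : subm_act (a * b) = (subm_act b \o subm_act a)%VF.
Proof.
apply/lfunP=> u; apply: val_inj; rewrite comp_lfunE /= !subm_actE.
by rewrite ractM comp_lfunE.
Qed.

Definition subm : rmodule A := RModule subm_act_linear subm_act1 subm_actM.

Definition submi : homA subm M.
Proof.
by apply: sval (@hom_of _ _ subm M vsval _ _) => [k x y|a x];
  rewrite ?linearP //= subm_actE.
Defined.

Lemma submiE u : submi u = vsval u.
Proof. by rewrite /submi; case: hom_of. Qed.

Lemma submi_inj : hinj submi.
Proof. by move=> x; rewrite submiE => x0; apply: val_inj. Qed.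

Lemma submi_mem u : submi u \in U.
Proof. by rewrite submiE subvsP. Qed.

Lemma submi_onto x : x \in U -> exists u, submi u = x.
Proof. by move=> xU; exists (vsproj U x); rewrite submiE vsprojK. Qed.

Lemma dim_subm : \dim (fullv : {vspace subm}) = \dim U.
Proof. by rewrite dimvf. Qed.

End Submodule.

(** The quotient is realised on the image of [\1 - projv U], a linear complement of [U]; the action
    is transported along the projection [p] and its linear section [s]. *)
Lemma quot_ex M (U : {vspace M}) : is_submod U ->
  exists N (p : homA M N), hsurj p /\ forall x, (p x == 0) = (x \in U).
Proof.
move=> Us; pose f : 'End(M) := (\1 - projv U)%VF.
have fU x : (f x == 0) = (x \in U).
  rewrite add_lfunE opp_lfunE id_lfunE subr_eq0.
  by apply/eqP/idP => [->|/projv_id]; first exact: memv_proj.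
pose V := subvs_of (limg f); pose p (x : M) : V := vsproj (limg f) (f x).
pose s (v : V) : M := (f^-1)%VF (vsval v).
have pE x : vsval (p x) = f x by rewrite vsprojK ?memv_img ?memvf.
have p0 x : (p x == 0) = (x \in U).
  by rewrite -fU -pE -(inj_eq val_inj).
have lp : linear p by move=> k x y; rewrite /p !linearP.
have ls : linear s by move=> k x y; rewrite /s !linearP.
have ps v : p (s v) = v by apply: val_inj; rewrite /= pE limg_lfunVK ?subvsP.
pose act a : 'End(V) := linfun (fun v => p (ract M a (s v))).
have actE a v : act a v = p (ract M a (s v)).
  by rewrite linfun_linearE // => k x y; rewrite ls linearP lp.
have pB x y : p (x - y) = p x - p y.
  by have := lp (-1) y x; rewrite !scaleN1r ![- _ + _]addrC.
have pact a x : p (ract M a x) = act a (p x).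
  rewrite actE; apply/subr0_eq; rewrite -pB -linearB; apply/eqP.
  by rewrite p0; apply: Us; rewrite -p0 pB ps subrr.
have a1 : linear act.
  move=> k a b; apply/lfunP=> v; rewrite !lfun_simp !actE.
  by rewrite ract_linear !lfun_simp lp.
have a2 : act 1 = \1%VF.
  by apply/lfunP=> v; rewrite actE ract1 !id_lfunE ps.
have a3 a b : act (a * b) = (act b \o act a)%VF.
  by apply/lfunP=> v; rewrite !lfun_simp actE ractM comp_lfunE pact -actE.
pose N : rmodule A := RModule a1 a2 a3.
have [g gE] := @hom_of _ _ M N p lp pact.
exists N, g; split=> [y|x]; last by rewrite gE p0.
by exists (s y); rewrite gE ps.
Qed.

Lemma proj_lift P M N (p : homA M N) (f : homA P N) :
  projective_mod P -> hsurj p -> exists h : homA P M, p \oA h = f.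
Proof.
move=> Pp /hsurjP ps; have [h hA E] := Pp _ _ _ _ (subvsP p) ps (subvsP f).
exists (mkhom hA); apply: hom_ext => x; rewrite hcompE mkhomE.
by rewrite /happ -E comp_lfunE.
Qed.

Lemma factor_inj M N T (i : homA T N) (f : homA M N) :
  hinj i -> (forall x, exists t, i t = f x) -> exists g : homA M T, i \oA g = f.
Proof.
move=> ii fi; pose g x := ((vsval i)^-1)%VF (f x).
have ig x : i (g x) = f x.
  have [t ft] := fi x; apply: limg_lfunVK; rewrite -ft; exact: memv_img (memvf t).
have lg : linear g by move=> k x y; rewrite /g !linearP.
have ga a x : g (ract M a x) = ract T a (g x).
  by apply: (hinj_eq ii); rewrite happA !ig happA.
have [h hh] := hom_of lg ga.
by exists h; apply: hom_ext => x; rewrite hcompE hh ig.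
Qed.

Lemma factor_surj M N L (p : homA M N) (f : homA M L) :
  hsurj p -> (forall x, p x = 0 -> f x = 0) -> exists g : homA N L, g \oA p = f.
Proof.
move=> ps pf; pose g y := f (((vsval p)^-1)%VF y).
have gp x : g (p x) = f x.
  apply/subr0_eq; rewrite -raddfB /=; apply: pf; apply/eqP; rewrite raddfB /= subr_eq0.
  by apply/eqP; apply: limg_lfunVK; apply: memv_img (memvf x).
have lg : linear g by move=> k x y; rewrite /g !linearP.
have ga a y : g (ract N a y) = ract L a (g y).
  by have [x <-] := ps y; rewrite -happA !gp happA.
have [h hh] := hom_of lg ga.
by exists h; apply: hom_ext => x; rewrite hcompE hh gp.
Qed.

(** After corestriction of both maps to the submodule [limg f], the first becomes surjective and
    projectivity applies. *)
Lemma proj_lift_img P M N (f : homA M N) (g : homA P N) :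
    projective_mod P -> (forall x, exists y, f y = g x) ->
  exists h : homA P M, f \oA h = g.
Proof.
move=> Pp fg; pose U := limg (vsval f).
have Us : is_submod U := @himg_submod _ _ f.
have [f' f'E] : exists f' : homA M (subm Us), submi Us \oA f' = f.
  apply: factor_inj => [|x]; first exact: submi_inj.
  by apply: submi_onto; apply: memv_img (memvf x).
have [g' g'E] : exists g' : homA P (subm Us), submi Us \oA g' = g.
  apply: factor_inj => [|x]; first exact: submi_inj.
  by apply: submi_onto; have [y <-] := fg x; apply: memv_img (memvf y).
have f's : hsurj f'.
  move=> u; have := submi_mem u => /memv_imgP[x _ ux].
  exists x; apply: (hinj_eq (@submi_inj _ _ Us)).
  by rewrite -hcompE f'E ux.
have [h hE] := proj_lift g' Pp f's.
by exists h; rewrite -f'E -hcompA hE.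
Qed.

Lemma ker_ex M N (f : homA M N) : exists T (i : homA T M),
  [/\ hinj i, f \oA i = 0 &
      forall L (g : homA L M), f \oA g = 0 -> exists h, i \oA h = g].
Proof.
exists (subm (@hker_submod _ _ f)), (submi _); split=> [||L g fg0].
- exact: submi_inj.
- apply: hom_ext => x; rewrite !hE.
  by have := submi_mem x; rewrite memv_ker => /eqP.
apply: factor_inj => [|x]; first exact: submi_inj.
by apply: submi_onto; rewrite memv_ker -/(happ f (g x)) -hcompE fg0 hE.
Qed.

Lemma coker_ex M N (f : homA M N) : exists C (p : homA N C),
  [/\ hsurj p, p \oA f = 0 & forall P (g : homA P N), projective_mod P ->
        p \oA g = 0 -> exists h, f \oA h = g].
Proof.
have [C [p [ps p0]]] := quot_ex (@himg_submod _ _ f).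
exists C, p; split=> // [|P g Pp pg].
  by apply: hom_ext => x; rewrite !hE; apply/eqP; rewrite p0; apply: memv_img (memvf x).
apply: proj_lift_img => // x.
have: g x \in limg (vsval f) by rewrite -p0 -hcompE pg hE.
by case/memv_imgP=> y _ ->; exists y.
Qed.

Lemma hbij_inv M N (f : homA M N) : hinj f -> hsurj f ->
  exists g : homA N M, f \oA g = hid N /\ g \oA f = hid M.
Proof.
move=> fi fs; have [g fg] := @factor_inj N N M f (hid N) fi (fun x => fs _).
exists g; split=> //; apply: (hinj_mono fi).
by rewrite hcompA fg hcomp1l hcomp1r.
Qed.

Definition dinl M N : homA M (dsum M N).
Proof.
apply: sval (@hom_of _ _ M (dsum M N) (fun x => (x, 0)) _ _) => [k x y|a x].
  by congr pair; rewrite /= scaler0 addr0.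
by rewrite /= dsum_actE /= linear0.
Defined.

Definition dinr M N : homA N (dsum M N).
Proof.
apply: sval (@hom_of _ _ N (dsum M N) (fun x => (0, x)) _ _) => [k x y|a x].
  by congr pair; rewrite /= scaler0 addr0.
by rewrite /= dsum_actE /= linear0.
Defined.

Definition dfst M N : homA (dsum M N) M.
Proof.
by apply: sval (@hom_of _ _ (dsum M N) M fst _ _) => [k x y|a x] //=;
  rewrite dsum_actE.
Defined.

Definition dsnd M N : homA (dsum M N) N.
Proof.
by apply: sval (@hom_of _ _ (dsum M N) N snd _ _) => [k x y|a x] //=;
  rewrite dsum_actE.
Defined.

Lemma dinlE M N x : dinl M N x = (x, 0).
Proof. by rewrite /dinl; case: hom_of. Qed.
Lemma dinrE M N x : dinr M N x = (0, x).
Proof. by rewrite /dinr; case: hom_of. Qed.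
Lemma dfstE M N x : dfst M N x = x.1.
Proof. by rewrite /dfst; case: hom_of. Qed.
Lemma dsndE M N x : dsnd M N x = x.2.
Proof. by rewrite /dsnd; case: hom_of. Qed.
Definition dE := (dinlE, dinrE, dfstE, dsndE).

Lemma dfst_inl M N : dfst M N \oA dinl M N = hid M.
Proof. by apply: hom_ext => x; rewrite !hE !dE. Qed.
Lemma dsnd_inr M N : dsnd M N \oA dinr M N = hid N.
Proof. by apply: hom_ext => x; rewrite !hE !dE. Qed.
Lemma dfst_inr M N : dfst M N \oA dinr M N = 0.
Proof. by apply: hom_ext => x; rewrite !hE !dE. Qed.
Lemma dsnd_inl M N : dsnd M N \oA dinl M N = 0.
Proof. by apply: hom_ext => x; rewrite !hE !dE. Qed.
Lemma dsum_id M N :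
  dinl M N \oA dfst M N + dinr M N \oA dsnd M N = hid (dsum M N).
Proof.
apply: hom_ext => -[x y]; rewrite !hE !dE /=.
by congr pair; rewrite /= ?addr0 ?add0r.
Qed.

Lemma retract_proj P Q (i : homA P Q) (p : homA Q P) :
  p \oA i = hid P -> projective_mod Q -> projective_mod P.
Proof.
move=> pi Qp M N q f qA qs fA; pose q' := mkhom qA; pose f' := mkhom fA.
have qE : vsval q' = q by rewrite vsprojK.
have q's : hsurj q' by apply/hsurjP; rewrite qE.
have [h hh] := proj_lift (f' \oA p) Qp q's.
exists (vsval (h \oA i)); first exact: subvsP.
apply/lfunP=> x; rewrite comp_lfunE -qE -/(happ q' _) -/(happ (h \oA i) x).
by rewrite -hcompE hcompA hh -hcompA pi hcomp1r mkhomE.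
Qed.

Lemma dsum_proj P Q :
  projective_mod P -> projective_mod Q -> projective_mod (dsum P Q).
Proof.
move=> Pp Qp M N q f qA qs fA; pose q' := mkhom qA; pose f' := mkhom fA.
have qE : vsval q' = q by rewrite vsprojK.
have q's : hsurj q' by apply/hsurjP; rewrite qE.
have [h1 h1E] := proj_lift (f' \oA dinl P Q) Pp q's.
have [h2 h2E] := proj_lift (f' \oA dinr P Q) Qp q's.
exists (vsval (h1 \oA dfst P Q + h2 \oA dsnd P Q)); first exact: subvsP.
apply/lfunP=> x; rewrite comp_lfunE -qE -/(happ q' _) -/(happ (h1 \oA dfst P Q + h2 \oA dsnd P Q) x).
by rewrite -hcompE hcompDr !hcompA h1E h2E -!hcompA -hcompDr dsum_id hcomp1r mkhomE.
Qed.

Lemma zero_mod_ex : exists Z : rmodule A, hid Z = 0.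
Proof.
have s0 : @is_submod K A (regular_mod A) 0%VS.
  by move=> a x; rewrite !memv0 => /eqP ->; rewrite linear0.
exists (subm s0); apply: hom_ext => x; rewrite !hE.
by apply: submi_inj; apply/eqP; rewrite -memv0 submi_mem.
Qed.

Lemma zero_mod_proj (Z : rmodule A) : hid Z = 0 -> projective_mod Z.
Proof.
move=> Z0 M N p f _ _ _; exists 0; first exact: mem0v.
apply/lfunP=> x; by rewrite -[x]hidE Z0 hE !linear0.
Qed.

End Constructions.

(** * Fitting's lemma for endomorphisms of two-term complexes *)

(** The idempotent is [e ^+ m * s ^+ m]. On its part [e] is inverted by [s]; on the complementary
    part [e ^+ m] vanishes, so [1 - e] is inverted by a geometric sum. The predicate [S] is a
    subring in which everything stays, later that of chain maps. *)
Lemma ring_fitting (R : pzRingType) (S : R -> Prop) (e s : R) (m : nat) :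
    S 1 -> (forall x y, S x -> S y -> S (x - y)) ->
    (forall x y, S x -> S y -> S (x * y)) ->
    S e -> S s -> GRing.comm e s -> e ^+ m = e ^+ m.+1 * s ->
  exists eps v w, [/\ [/\ S eps, S v & S w], eps * eps = eps,
    v * e * eps = eps & w * (1 - e) * (1 - eps) = 1 - eps].
Proof.
move=> S1 SB SM Se Ss es em.
have emk k : e ^+ m = e ^+ (m + k) * s ^+ k.
  elim: k => [|k IHk]; first by rewrite addn0 mulr1.
  have -> : (m + k.+1 = k + m.+1)%N by rewrite !addnS addnC.
  by rewrite exprD (exprS s) mulrA -(mulrA (e ^+ k)) -em -exprD addnC.
pose eps := e ^+ m * s ^+ m.
have cem i j : e ^+ i * s ^+ j = s ^+ j * e ^+ i.
  exact/commrX/commr_sym/commrX/commr_sym.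
have eeps : e ^+ m * eps = e ^+ m by rewrite /eps mulrA -exprD -emk.
have SX x k : S x -> S (x ^+ k).
  by move=> Sx; elim: k => [|k IHk] //; rewrite exprS; apply: SM.
have idem : eps * eps = eps.
  by rewrite {1}/eps cem -mulrA eeps /eps cem.
exists eps, s, (\sum_(i < m) e ^+ i); split=> //.
- split=> //; first by apply: SM; apply: SX.
  have S0 : S 0 by rewrite -(subrr 1); apply: SB.
  elim/big_ind: _ => // [x y Sx Sy|i _]; last exact: SX.
  by rewrite -[y]opprK; apply: (SB) => //; rewrite -sub0r; apply: SB.
- rewrite -es /eps mulrA -(mulrA e) -[s in X in X * _]expr1 -cem mulrA.
  by rewrite expr1 -exprS -em.
have cew : GRing.comm (\sum_(i < m) e ^+ i) (1 - e).
  apply/commr_sym/commr_sum => i _; apply/commrX/commr_sym/commrB => //.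
  exact: commr1.
have sumE : (\sum_(i < m) e ^+ i) * (1 - e) = 1 - e ^+ m.
  by rewrite cew -opprB mulNr -subrX1 opprB.
by rewrite sumE mulrBl mul1r mulrBr mulr1 eeps subrr subr0.
Qed.

Lemma span_ind (K : fieldType) (V : vectType K) (Q : V -> Prop) (X : seq V) :
    Q 0 -> (forall k x y, Q x -> Q y -> Q (k *: x + y)) ->
    {in X, forall x, Q x} -> forall v, v \in <<X>>%VS -> Q v.
Proof.
move=> Q0 QD; elim: X => [|x X IHX] QX v.
  by rewrite span_nil memv0 => /eqP ->.
rewrite span_cons => /memv_addP[_ /vlineP[k ->] [w wX ->]].
apply: QD; first by apply: QX; rewrite mem_head.
by apply: IHX => // y yX; apply: QX; rewrite inE yX orbT.
Qed.

Section EndRing.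
Variables (K : fieldType) (A : falgType K).
Implicit Types L M N P Q T : rmodule A.

HB.instance Definition _ M := GRing.Zmodule_isPzRing.Build (homA M M)
  (fun f g h => hcompA f g h) (@hcomp1l _ _ M M) (@hcomp1r _ _ M M)
  (fun f g h => hcompDl f g h) (fun f g h => hcompDr f g h).

Definition chain_map M1 M0 N1 N0 (d : homA M1 M0) (d' : homA N1 N0)
  (w1 : homA M1 N1) (w0 : homA M0 N0) := d' \oA w1 = w0 \oA d.

Lemma chain_map_comp L1 L0 M1 M0 N1 N0 (d : homA L1 L0) (d' : homA M1 M0)
    (d'' : homA N1 N0) v1 v0 w1 w0 :
  chain_map d' d'' v1 v0 -> chain_map d d' w1 w0 ->
  chain_map d d'' (v1 \oA w1) (v0 \oA w0).
Proof. by rewrite /chain_map => vc wc; rewrite hcompA vc -hcompA wc hcompA. Qed.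

(** The powers of [e] are linearly dependent in the finite dimensional product of the two
    endomorphism rings. Solving a relation for its lowest power gives [s] as a polynomial in [e],
    hence a chain map commuting with [e]. *)
Lemma chain_stab M1 M0 (d : homA M1 M0) (e : homA M1 M1 * homA M0 M0) :
    chain_map d d e.1 e.2 -> exists m (s : homA M1 M1 * homA M0 M0),
  [/\ chain_map d d s.1 s.2, GRing.comm e s & e ^+ m = e ^+ m.+1 * s].
Proof.
move=> ec; pose V := (homA M1 M1 * homA M0 M0)%type.
pose D := \dim (fullv : {vspace V}).
pose X := [tuple of mkseq (fun k => e ^+ k : V) D.+1].
have chD k (x y : V) : chain_map d d x.1 x.2 -> chain_map d d y.1 y.2 ->
    chain_map d d (k *: x + y).1 (k *: x + y).2.
  by rewrite /chain_map /= !hDE => -> ->.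
have chX k : chain_map d d (e ^+ k).1 (e ^+ k).2.
  elim: k => [|k IHk]; first by rewrite /chain_map /= hcomp1l hcomp1r.
  by rewrite exprS; exact: (chain_map_comp ec IHk).
have XE k : (k < D.+1)%N -> X`_k = e ^+ k by exact: nth_mkseq.
have : ~~ free X.
  apply/negP; rewrite /free size_tuple => /eqP dX.
  by have := dimvS (subvf <<X>>%VS); rewrite dX ltnn.
(* Non-freeness provides a power [e ^+ i] in the span of the strictly higher ones. *)
rewrite freeNE => /existsP[i].
rewrite XE // => eiX.
pose Q (x : V) := exists s : V,
  [/\ chain_map d d s.1 s.2, GRing.comm e s & x = e ^+ i.+1 * s].
suff: Q (e ^+ i) by case=> s Qs; exists i, s.
have mulZ (f g : V) k : f * (k *: g) = k *: (f * g).
  by congr pair; apply: hcompZr.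
have mulZl (f g : V) k : (k *: f) * g = k *: (f * g).
  by congr pair; apply: hcompZl.
apply: span_ind eiX => [|k x y [s [s1 s2 ->]] [t [t1 t2 ->]]|x].
- exists 0; split; rewrite ?mulr0 //; last exact: commr0.
  by rewrite /chain_map /= !hDE.
- exists (k *: s + t); split; first exact: chD.
    by rewrite /GRing.comm mulrDr mulrDl mulZ mulZl s2 t2.
  by rewrite mulrDr mulZ.
case/(nthP 0) => j; rewrite size_drop size_tuple => jX <-.
rewrite nth_drop XE; last by rewrite -ltn_subRL.
exists (e ^+ j); split=> //; first exact/commrX.
by rewrite exprD.
Qed.

Lemma split_idem M (eps : homA M M) : eps \oA eps = eps ->
  exists T (i : homA T M) (p : homA M T), p \oA i = hid T /\ i \oA p = eps.
Proof.
move=> ee; have [T [i [ii i0 iu]]] := ker_ex (hid M - eps).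
have [|p ip] := iu _ eps; first by rewrite hcompBl hcomp1l ee subrr.
exists T, i, p; split=> //; apply: (hinj_mono ii).
rewrite hcompA ip hcomp1r; apply/esym/eqP; rewrite -subr_eq0.
by rewrite -{1}[i]hcomp1l -hcompBl i0.
Qed.

(** Working in the product of the two endomorphism rings treats both degrees at once, and makes the
    idempotents and the partial inverses chain maps. *)
Lemma chain_fitting M1 M0 (d : homA M1 M0) (e1 : homA M1 M1) (e0 : homA M0 M0) :
    chain_map d d e1 e0 ->
  exists p1 p0 v1 v0 w1 w0,
  [/\ [/\ chain_map d d p1 p0, chain_map d d v1 v0 & chain_map d d w1 w0],
      p1 \oA p1 = p1 /\ p0 \oA p0 = p0,
      v1 \oA e1 \oA p1 = p1 /\ v0 \oA e0 \oA p0 = p0 &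
      w1 \oA (hid _ - e1) \oA (hid _ - p1) = hid _ - p1 /\
      w0 \oA (hid _ - e0) \oA (hid _ - p0) = hid _ - p0].
Proof.
move=> ec; have [m [s [sc es em]]] := @chain_stab _ _ d (e1, e0) ec.
pose S (x : homA M1 M1 * homA M0 M0) := chain_map d d x.1 x.2.
have [|x y|x y|eps [v [w [[S1 S2 S3] i1 i2 i3]]]] :=
  @ring_fitting _ S (e1, e0) _ _ _ _ _ ec sc es em.
- by rewrite /S /chain_map /= hcomp1l hcomp1r.
- by rewrite /S /chain_map /= !hDE => -> ->.
- exact: chain_map_comp.
have f1 : (1 : homA M1 M1 * homA M0 M0).1 = hid M1 by [].
have s1 : (1 : homA M1 M1 * homA M0 M0).2 = hid M0 by [].
have fM (x y : homA M1 M1 * homA M0 M0) : (x * y).1 = x.1 \oA y.1 by [].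
have sM (x y : homA M1 M1 * homA M0 M0) : (x * y).2 = x.2 \oA y.2 by [].
have fB (x y : homA M1 M1 * homA M0 M0) : (x - y).1 = x.1 - y.1 by [].
have sB (x y : homA M1 M1 * homA M0 M0) : (x - y).2 = x.2 - y.2 by [].
exists eps.1, eps.2, v.1, v.2, w.1, w.2; split=> //.
- by split; [have := congr1 fst i1; rewrite fM | have := congr1 snd i1; rewrite sM].
- by split; [have := congr1 fst i2; rewrite !fM | have := congr1 snd i2; rewrite !sM].
- split; first by have := congr1 fst i3; rewrite !fM !fB !f1.
  by have := congr1 snd i3; rewrite !sM !sB !s1.
Qed.

End EndRing.

(** * Two-term complexes and additive functions on modules *)

(** The terms are arbitrary modules, because kernels of chain maps also occur; projectivity is
    assumed wherever a lifting requires it. *)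
Record cplx (K : fieldType) (A : falgType K) := Cplx {
  cpx1 : rmodule A;
  cpx0 : rmodule A;
  cpxd : homA cpx1 cpx0
}.

Section Complexes.
Variables (K : fieldType) (A : falgType K).
Implicit Types (M N P Q : rmodule A) (X Y Z T : cplx A).

Definition ishom X Y (w1 : homA (cpx1 X) (cpx1 Y)) (w0 : homA (cpx0 X) (cpx0 Y)) :=
  chain_map (cpxd X) (cpxd Y) w1 w0.

(* Hom(X, Y[1]) = 0 in the homotopy category. *)
Definition orth X Y := forall f : homA (cpx1 X) (cpx0 Y),
  exists (h : homA (cpx0 X) (cpx0 Y)) (s : homA (cpx1 X) (cpx1 Y)),
    f = h \oA cpxd X + cpxd Y \oA s.

(** The differential is locked, so that simplification leaves it alone and it is handled through the
    four compatibilities with injections and projections below. *)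
Definition csum X Y : cplx A :=
  Cplx (locked (dinl _ _ \oA cpxd X \oA dfst _ _ +
                dinr _ _ \oA cpxd Y \oA dsnd _ _)).

Lemma csum_dinl X Y :
  cpxd (csum X Y) \oA dinl _ _ = dinl _ _ \oA cpxd X.
Proof.
by rewrite /= -lock hcompDl -!hcompA dfst_inl dsnd_inl !hcomp0r hcomp1r addr0.
Qed.

Lemma csum_dinr X Y :
  cpxd (csum X Y) \oA dinr _ _ = dinr _ _ \oA cpxd Y.
Proof.
by rewrite /= -lock hcompDl -!hcompA dfst_inr dsnd_inr !hcomp0r hcomp1r add0r.
Qed.

Lemma csum_dfst X Y :
  dfst _ _ \oA cpxd (csum X Y) = cpxd X \oA dfst _ _.
Proof.
by rewrite /= -lock hcompDr !hcompA dfst_inl dfst_inr !hcomp0l hcomp1l addr0.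
Qed.

Lemma csum_dsnd X Y :
  dsnd _ _ \oA cpxd (csum X Y) = cpxd Y \oA dsnd _ _.
Proof.
by rewrite /= -lock hcompDr !hcompA dsnd_inl dsnd_inr !hcomp0l hcomp1l add0r.
Qed.

Lemma orth_csumr X Y Z : orth X Y -> orth X Z -> orth X (csum Y Z).
Proof.
move=> oY oZ f; have [h [s fE]] := oY (dfst _ _ \oA f).
have [h' [s' fE']] := oZ (dsnd _ _ \oA f).
exists (dinl _ _ \oA h + dinr _ _ \oA h'), (dinl _ _ \oA s + dinr _ _ \oA s').
rewrite -[LHS]hcomp1l -dsum_id hcompDl -!hcompA fE fE' hcompDl.
rewrite [in RHS]hcompDr !hcompDr.
rewrite [cpxd (csum Y Z) \oA (dinl _ _ \oA s)]hcompA csum_dinl.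
rewrite [cpxd (csum Y Z) \oA (dinr _ _ \oA s')]hcompA csum_dinr.
by rewrite -!hcompA addrACA.
Qed.

Lemma orth_csuml X Y Z : orth X Z -> orth Y Z -> orth (csum X Y) Z.
Proof.
move=> oX oY f; have [h [s fE]] := oX (f \oA dinl _ _).
have [h' [s' fE']] := oY (f \oA dinr _ _).
exists (h \oA dfst _ _ + h' \oA dsnd _ _), (s \oA dfst _ _ + s' \oA dsnd _ _).
rewrite -[LHS]hcomp1r -dsum_id hcompDr !hcompA fE fE' hcompDr !hcompDl.
by rewrite -!(hcompA _ _ (cpxd (csum X Y))) csum_dfst csum_dsnd !hcompA addrACA.
Qed.

Lemma chain_split X p1 p0 : @ishom X X p1 p0 ->
    p1 \oA p1 = p1 -> p0 \oA p0 = p0 ->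
  exists T i1 i0 q1 q0, [/\ @ishom T X i1 i0, @ishom X T q1 q0,
    q1 \oA i1 = hid _ /\ q0 \oA i0 = hid _ & i1 \oA q1 = p1 /\ i0 \oA q0 = p0].
Proof.
rewrite /ishom /chain_map => pc /split_idem[T1 [i1 [q1 [qi1 iq1]]]].
case/split_idem=> T0 [i0 [q0 [qi0 iq0]]].
exists (Cplx (q0 \oA cpxd X \oA i1)), i1, i0, q1, q0; split=> //=.
  by rewrite !hcompA iq0 -pc -iq1 -!hcompA qi1 hcomp1r.
by rewrite -hcompA iq1 -hcompA pc hcompA -iq0 hcompA qi0 hcomp1l.
Qed.

Section Additive.
Variables (V : zmodType) (mu : rmodule A -> V).
Hypothesis mu_add : forall M M1 M2 (i1 : homA M1 M) (i2 : homA M2 M) p1 p2,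
  p1 \oA i1 = hid M1 -> p2 \oA i2 = hid M2 -> i1 \oA p1 + i2 \oA p2 = hid M ->
  mu M = mu M1 + mu M2.

(** A zero module is the direct sum of two copies of itself. *)
Lemma mu_zero (Z : rmodule A) : hid Z = 0 -> mu Z = 0.
Proof.
move=> Z0; apply: (addrI (mu Z)); rewrite addr0 -(@mu_add Z Z Z 0 0 0 0) //.
- by rewrite hcomp0l Z0.
- by rewrite hcomp0l Z0.
- by rewrite hcomp0l addr0 Z0.
Qed.

Lemma mu_iso M N (f : homA M N) (g : homA N M) :
  f \oA g = hid N -> g \oA f = hid M -> mu M = mu N.
Proof.
move=> fg gf; have [Z Z0] := zero_mod_ex A.
rewrite (@mu_add M N Z g 0 f 0) ?(mu_zero Z0) ?addr0 //.
- by rewrite hcomp0l Z0.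
- by rewrite hcomp0l addr0.
Qed.

Lemma mu_dsum M N : mu (dsum M N) = mu M + mu N.
Proof. exact: mu_add (dfst_inl M N) (dsnd_inr M N) (dsum_id M N). Qed.

(* mu takes equal values on both terms of every direct summand of X. *)
Definition good X := forall Y q1 q0 p1 p0, @ishom Y X q1 q0 ->
  @ishom X Y p1 p0 -> p1 \oA q1 = hid _ -> p0 \oA q0 = hid _ ->
  mu (cpx0 Y) = mu (cpx1 Y).

Lemma good_self X : good X -> mu (cpx0 X) = mu (cpx1 X).
Proof.
move=> gX; apply: (gX X (hid _) (hid _) (hid _) (hid _));
  by rewrite /ishom /chain_map ?hcomp1l ?hcomp1r.
Qed.

Lemma good_zero X : hid (cpx1 X) = 0 -> hid (cpx0 X) = 0 -> good X.
Proof.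
move=> X1 X0 Y q1 q0 p1 p0 _ _ Y1 Y0; rewrite !mu_zero //.
  by rewrite -Y1 -[q1]hcomp1l X1 hcomp0l hcomp0r.
by rewrite -Y0 -[q0]hcomp1l X0 hcomp0l hcomp0r.
Qed.

(** The differential of a direct summand of an identity complex is invertible, with inverse
    [p1 \oA q0]. *)
Lemma good_id Q : good (Cplx (hid Q)).
Proof.
move=> Y q1 q0 p1 p0; rewrite /ishom /chain_map /= hcomp1l hcomp1r => q1E p1E.
move=> pq1 pq0; apply/esym/(@mu_iso _ _ (cpxd Y) (p1 \oA q0)).
  by rewrite hcompA p1E.
by rewrite -hcompA -q1E.
Qed.

(** The idempotent of [X] cut out by a summand [Y] is zero or the identity, so that [Y] is zero or
    isomorphic to [X] in each degree. *)
Lemma good_indec X :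
    (forall e1 e0, @ishom X X e1 e0 -> e1 \oA e1 = e1 -> e0 \oA e0 = e0 ->
       (e1 = 0 /\ e0 = 0) \/ (e1 = hid _ /\ e0 = hid _)) ->
  mu (cpx0 X) = mu (cpx1 X) -> good X.
Proof.
move=> Xi muX Y q1 q0 p1 p0 qc pc pq1 pq0.
have idem M N (q : homA M N) (p : homA N M) : p \oA q = hid _ ->
    (q \oA p) \oA (q \oA p) = q \oA p.
  by move=> pq; rewrite hcompA -(hcompA q) pq hcomp1r.
have z M N (q : homA M N) (p : homA N M) : p \oA q = hid _ -> q \oA p = 0 ->
    mu M = 0.
  move=> pq qp; apply: mu_zero; rewrite -[LHS]hcomp1l -pq -hcompA.
  by rewrite (hcompA q) qp hcomp0l hcomp0r.
have := Xi (q1 \oA p1) (q0 \oA p0) (chain_map_comp qc pc) (idem _ _ _ _ pq1)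
  (idem _ _ _ _ pq0).
case=> -[qp1 qp0]; first by rewrite (z _ _ _ _ pq0 qp0) (z _ _ _ _ pq1 qp1).
by rewrite (mu_iso qp0 pq0) (mu_iso qp1 pq1).
Qed.

(** Here [e] factors through [X] as [a] after [b], and [v] inverts it on the summand [T] of [Y].
    Then [b \oA i] and [p \oA v \oA a] exhibit [T] as a summand of [X]. *)
Lemma good_factor X Y e1 e0 v1 v0 b1 b0 a1 a0 T i1 i0 p1 p0 :
    good X -> @ishom Y X b1 b0 -> @ishom X Y a1 a0 ->
    a1 \oA b1 = e1 -> a0 \oA b0 = e0 -> @ishom Y Y v1 v0 ->
    @ishom T Y i1 i0 -> @ishom Y T p1 p0 ->
    p1 \oA i1 = hid _ -> p0 \oA i0 = hid _ ->
    v1 \oA e1 \oA (i1 \oA p1) = i1 \oA p1 -> v0 \oA e0 \oA (i0 \oA p0) = i0 \oA p0 ->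
  mu (cpx0 T) = mu (cpx1 T).
Proof.
move=> gX bc ac ab1 ab0 vc ic pc pi1 pi0 ve1 ve0.
have E M N (i : homA M N) p (e v : homA N N) : p \oA i = hid _ ->
    v \oA e \oA (i \oA p) = i \oA p -> p \oA v \oA e \oA i = hid _.
  move=> pi ve; transitivity (p \oA (v \oA e \oA (i \oA p)) \oA i).
    by rewrite -!hcompA pi hcomp1r.
  by rewrite ve -!hcompA pi hcomp1r.
apply: (gX T (b1 \oA i1) (b0 \oA i0) (p1 \oA v1 \oA a1) (p0 \oA v0 \oA a0)).
- exact: chain_map_comp bc ic.
- exact: chain_map_comp (chain_map_comp pc vc) ac.
- by rewrite hcompA -(hcompA _ a1) ab1; apply: E.
- by rewrite hcompA -(hcompA _ a0) ab0; apply: E.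
Qed.

(* Fitting: with e = p q through X, either e or 1 - e is invertible on each
   half of Y, so that Y is a summand of X plus a summand of X'. *)
Lemma good_csum X X' : good X -> good X' -> good (csum X X').
Proof.
move=> gX gX' Y q1 q0 p1 p0 qc pc pq1 pq0.
pose e1 := (p1 \oA dinl _ _) \oA (dfst _ _ \oA q1).
pose e0 := (p0 \oA dinl _ _) \oA (dfst _ _ \oA q0).
have fc : @ishom (csum X X') X (dfst _ _) (dfst _ _) by rewrite /ishom /chain_map csum_dfst.
have sc : @ishom (csum X X') X' (dsnd _ _) (dsnd _ _) by rewrite /ishom /chain_map csum_dsnd.
have lc : @ishom X (csum X X') (dinl _ _) (dinl _ _) by rewrite /ishom /chain_map csum_dinl.
have rc : @ishom X' (csum X X') (dinr _ _) (dinr _ _) by rewrite /ishom /chain_map csum_dinr.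
have bc := chain_map_comp fc qc; have ac := chain_map_comp pc lc.
have bc' := chain_map_comp sc qc; have ac' := chain_map_comp pc rc.
have ec : @ishom Y Y e1 e0 := chain_map_comp ac bc.
(* What passes through [X'] is the complement of what passes through [X]. *)
have e'1 : (p1 \oA dinr _ _) \oA (dsnd _ _ \oA q1) = hid _ - e1.
  apply/esym/eqP; rewrite subr_eq; apply/eqP; rewrite -pq1 -[q1 in LHS]hcomp1l -dsum_id hcompDl hcompDr.
  by rewrite /e1 -!hcompA addrC.
have e'0 : (p0 \oA dinr _ _) \oA (dsnd _ _ \oA q0) = hid _ - e0.
  apply/esym/eqP; rewrite subr_eq; apply/eqP; rewrite -pq0 -[q0 in LHS]hcomp1l -dsum_id hcompDl hcompDr.
  by rewrite /e0 -!hcompA addrC.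
have [r1 [r0 [v1 [v0 [w1 [w0 []]]]]]] := chain_fitting ec.
move=> [rc1 vc wc] [rr1 rr0] [ve1 ve0] [we1 we0].
have [T [i1 [i0 [s1 [s0 [ic sic [si1 si0] [is1 is0]]]]]]] := chain_split rc1 rr1 rr0.
have r'c : @ishom Y Y (hid _ - r1) (hid _ - r0).
  by rewrite /ishom /chain_map !(hcompBl, hcompBr) hcomp1l hcomp1r rc1.
have rr' M (r : homA M M) : r \oA r = r -> (hid _ - r) \oA (hid _ - r) = hid _ - r.
  by move=> rr; rewrite !(hcompBl, hcompBr) !hcomp1l hcomp1r rr subrr subr0.
have [T' [i'1 [i'0 [s'1 [s'0 [i'c s'c [si'1 si'0] [is'1 is'0]]]]]]] :=
  chain_split r'c (rr' _ _ rr1) (rr' _ _ rr0).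
have h1 : i1 \oA s1 + i'1 \oA s'1 = hid _ by rewrite is1 is'1 addrC subrK.
rewrite (mu_add si1 si'1 h1).
have h0 : i0 \oA s0 + i'0 \oA s'0 = hid _ by rewrite is0 is'0 addrC subrK.
rewrite (mu_add si0 si'0 h0).
congr (_ + _).
  apply: (good_factor gX bc ac (erefl e1) (erefl e0) vc ic sic) => //.
    by rewrite is1.
  by rewrite is0.
apply: (good_factor gX' bc' ac' e'1 e'0 wc i'c s'c) => //.
  by rewrite is'1.
by rewrite is'0.
Qed.

End Additive.
End Complexes.

(** * Approximations by sums of the complexes [X i], and the silting argument *)

Section Approximation.
Variables (K : fieldType) (A : falgType K) (I : finType) (X : I -> cplx A).
Implicit Types (M N P Q : rmodule A) (Y Z : cplx A) (i : I).

(** Finite sums with repetitions, starting from any complex with zero terms. *)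
Inductive insum : cplx A -> Prop :=
| insum0 Z : hid (cpx1 Z) = 0 -> hid (cpx0 Z) = 0 -> insum Z
| insumS i Z : insum Z -> insum (csum (X i) Z).

Lemma insum_nil : exists Z, insum Z.
Proof. by have [Z Z0] := zero_mod_ex A; exists (Cplx (hid Z)); apply: insum0. Qed.

Lemma insum_orthr Y Z : (forall i, orth Y (X i)) -> insum Z -> orth Y Z.
Proof.
move=> oX; elim=> [{}Z Z1 Z0 f|i {}Z _ IHZ]; last exact: orth_csumr.
by exists 0, 0; rewrite hcomp0l hcomp0r addr0 -[f]hcomp1l Z0 hcomp0l.
Qed.

Lemma insum_orthl Y Z : (forall i, orth (X i) Y) -> insum Z -> orth Z Y.
Proof.
move=> oX; elim=> [{}Z Z1 Z0 f|i {}Z _ IHZ]; last exact: orth_csuml.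
by exists 0, 0; rewrite hcomp0l hcomp0r addr0 -[f]hcomp1r Z1 hcomp0r.
Qed.

Lemma insum_proj Z :
    (forall i, projective_mod (cpx1 (X i)) /\ projective_mod (cpx0 (X i))) ->
  insum Z -> projective_mod (cpx1 Z) /\ projective_mod (cpx0 Z).
Proof.
move=> Xp; elim=> [{}Z Z1 Z0|i {}Z _ [Z1 Z0]]; first by split; apply: zero_mod_proj.
by have [X1 X0] := Xp i; split; apply: dsum_proj.
Qed.

Lemma insum_good (V : zmodType) (mu : rmodule A -> V) Z :
    (forall M M1 M2 (i1 : homA M1 M) (i2 : homA M2 M) p1 p2,
      p1 \oA i1 = hid M1 -> p2 \oA i2 = hid M2 ->
      i1 \oA p1 + i2 \oA p2 = hid M -> mu M = mu M1 + mu M2) ->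
  (forall i, good mu (X i)) -> insum Z -> good mu Z.
Proof.
move=> mu_add Xg; elim=> [{}Z Z1 Z0|i {}Z _ IHZ]; first exact: good_zero.
exact: good_csum.
Qed.

(** The factorisation is strict, not merely up to homotopy. *)
Definition factors Y Z Z' (g1 : homA (cpx1 Z) (cpx1 Y)) (g0 : homA (cpx0 Z) (cpx0 Y))
  (w1 : homA (cpx1 Z') (cpx1 Y)) (w0 : homA (cpx0 Z') (cpx0 Y)) :=
  exists u1 u0, [/\ @ishom K A Z' Z u1 u0, g1 \oA u1 = w1 & g0 \oA u0 = w0].

Lemma factors_trans Y Z Z' Z'' g1 g0 h1 h0 w1 w0 :
  @factors Y Z Z' g1 g0 h1 h0 -> @factors Y Z' Z'' h1 h0 w1 w0 ->
  factors g1 g0 w1 w0.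
Proof.
move=> [u1 [u0 [uc <- <-]]] [v1 [v0 [vc <- <-]]].
exists (u1 \oA v1), (u0 \oA v0); split; rewrite ?hcompA //.
exact: chain_map_comp uc vc.
Qed.

(** Chain maps from [X i] to [Y] form a finite dimensional space [U i]. One copy of [X i] is
    adjoined for each vector of a basis of [U i], and factorisations are closed under linear
    combinations. *)
Lemma right_approx Y : exists Z g1 g0, [/\ insum Z, @ishom K A Z Y g1 g0 &
  forall i w1 w0, @ishom K A (X i) Y w1 w0 -> factors g1 g0 w1 w0].
Proof.
pose H i := (homA (cpx1 (X i)) (cpx1 Y) * homA (cpx0 (X i)) (cpx0 Y))%type.
pose ch i (w : H i) := ishom w.1 w.2.
have chB i k (v w : H i) : ch i v -> ch i w -> ch i (k *: v + w).
  by rewrite /ch /ishom /chain_map /= !hDE => -> ->.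
pose U i : {vspace H i} :=
  lker (linfun (fun w : H i => cpxd Y \oA w.1 - w.2 \oA cpxd (X i))).
have UP i (w : H i) : reflect (ch i w) (w \in U i).
  rewrite memv_ker linfun_linearE; first by rewrite subr_eq0; apply: eqP.
  by move=> k x y; rewrite /= !hDE scalerBr opprD addrACA.
have step i (w : H i) Z g1 g0 : ch i w -> insum Z -> @ishom K A Z Y g1 g0 ->
    exists Z' g1' g0', [/\ insum Z', @ishom K A Z' Y g1' g0',
      factors g1' g0' g1 g0 & factors g1' g0' w.1 w.2].
  move=> wc Zs gc; exists (csum (X i) Z).
  exists (w.1 \oA dfst _ _ + g1 \oA dsnd _ _), (w.2 \oA dfst _ _ + g0 \oA dsnd _ _).
  split; first exact: insumS.
  - rewrite /ishom /chain_map hcompDr hcompDl !hcompA wc gc -!hcompA.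
    by rewrite csum_dfst csum_dsnd.
  - exists (dinr _ _), (dinr _ _); split; first by rewrite /ishom /chain_map csum_dinr.
      by rewrite hcompDl -!hcompA dfst_inr dsnd_inr hcomp0r hcomp1r add0r.
    by rewrite hcompDl -!hcompA dfst_inr dsnd_inr hcomp0r hcomp1r add0r.
  - exists (dinl _ _), (dinl _ _); split; first by rewrite /ishom /chain_map csum_dinl.
      by rewrite hcompDl -!hcompA dfst_inl dsnd_inl hcomp0r hcomp1r addr0.
    by rewrite hcompDl -!hcompA dfst_inl dsnd_inl hcomp0r hcomp1r addr0.
have steps i (s : seq (H i)) : {in s, forall w, ch i w} ->
    forall Z g1 g0, insum Z -> @ishom K A Z Y g1 g0 ->
    exists Z' g1' g0', [/\ insum Z', @ishom K A Z' Y g1' g0',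
      factors g1' g0' g1 g0 & {in s, forall w, factors g1' g0' w.1 w.2}].
  elim: s => [|w s IHs] sc Z g1 g0 Zs gc.
    exists Z, g1, g0; split=> //; exists (hid _), (hid _).
    by rewrite /ishom /chain_map !hcomp1l !hcomp1r.
  have wc : ch i w by apply: sc; rewrite mem_head.
  have [Z' [h1 [h0 [Z's hc hg hw]]]] := step i w Z g1 g0 wc Zs gc.
  have [|Z'' [k1 [k0 [Z''s kc kh ks]]]] := IHs _ Z' h1 h0 Z's hc.
    by move=> v vs; apply: sc; rewrite inE vs orbT.
  exists Z'', k1, k0; split=> //; first exact: factors_trans kh hg.
  move=> v; rewrite inE => /predU1P[->|/ks //]; exact: factors_trans kh hw.
have stepi i Z g1 g0 : insum Z -> @ishom K A Z Y g1 g0 ->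
    exists Z' g1' g0', [/\ insum Z', @ishom K A Z' Y g1' g0',
      factors g1' g0' g1 g0 & forall w, ch i w -> factors g1' g0' w.1 w.2].
  move=> Zs gc; have [|Z' [h1 [h0 [Z's hc hg hU]]]] := steps i (vbasis (U i)) _ Z g1 g0 Zs gc.
    by move=> w /vbasis_mem /UP.
  exists Z', h1, h0; split=> // w /UP; rewrite -(span_basis (vbasisP (U i))).
  apply: (@span_ind _ _ (fun w : H i => factors h1 h0 w.1 w.2))
    => [|k v {}w|v vU]; last exact: hU.
    by exists 0, 0; rewrite /ishom /chain_map !(hcomp0r, hcomp0l).
  move=> [u1 [u0 [uc u1E u0E]]] [v1 [v0 [vc v1E v0E]]].
  exists (k *: u1 + v1), (k *: u0 + v0); rewrite /= -u1E -u0E -v1E -v0E.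
  by split; rewrite /ishom /chain_map !hDE ?uc ?vc.
have stepI (s : seq I) : exists Z g1 g0, [/\ insum Z, @ishom K A Z Y g1 g0 &
    {in s, forall i (w : H i), ch i w -> factors g1 g0 w.1 w.2}].
  elim: s => [|i s [Z [g1 [g0 [Zs gc gs]]]]].
    have [Z Zs] := insum_nil; exists Z, 0, 0; split=> //.
    by rewrite /ishom /chain_map hcomp0l hcomp0r.
  have [Z' [h1 [h0 [Z's hc hg hi]]]] := stepi i Z g1 g0 Zs gc.
  exists Z', h1, h0; split=> // j; rewrite inE => /predU1P[-> //|/gs js w wc].
  exact: factors_trans hg (js w wc).
have [Z [g1 [g0 [Zs gc gI]]]] := stepI (enum I).
exists Z, g1, g0; split=> // i w1 w0 wc.
exact: (gI i (mem_enum _ i) (w1, w0) wc).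
Qed.

(** The module [P] stands for the complex with [P] in degree 0 and zero in degree 1, whose chain
    maps to [Z] are just the maps from [P] to [cpx0 Z]. As before, one copy of [X i] is adjoined for
    each vector of a basis of the maps from [P] to [cpx0 (X i)]. *)
Lemma left_approx P : exists Z (f : homA P (cpx0 Z)), insum Z /\
  forall i (u : homA P (cpx0 (X i))),
    exists w1 w0, @ishom K A Z (X i) w1 w0 /\ w0 \oA f = u.
Proof.
pose fac Z Z' (f : homA P (cpx0 Z)) (u : homA P (cpx0 Z')) :=
  exists w1 w0, @ishom K A Z Z' w1 w0 /\ w0 \oA f = u.
have ftrans Z Z' Z'' f g h : fac Z Z' f g -> fac Z' Z'' g h -> fac Z Z'' f h.
  move=> [u1 [u0 [uc <-]]] [v1 [v0 [vc <-]]].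
  exists (v1 \oA u1), (v0 \oA u0); split; last by rewrite hcompA.
  exact: chain_map_comp vc uc.
have step i u Z f : insum Z ->
    exists Z' f', [/\ insum Z', fac Z' Z f' f & fac Z' (X i) f' u].
  move=> Zs; exists (csum (X i) Z), (dinl _ _ \oA u + dinr _ _ \oA f).
  split; first exact: insumS.
    exists (dsnd _ _), (dsnd _ _); rewrite /ishom /chain_map csum_dsnd; split=> //.
    by rewrite hcompDr !hcompA dsnd_inl dsnd_inr hcomp0l hcomp1l add0r.
  exists (dfst _ _), (dfst _ _); rewrite /ishom /chain_map csum_dfst; split=> //.
  by rewrite hcompDr !hcompA dfst_inl dfst_inr hcomp0l hcomp1l addr0.
have steps i (s : seq (homA P (cpx0 (X i)))) Z f : insum Z ->
    exists Z' f', [/\ insum Z', fac Z' Z f' f & {in s, forall u, fac Z' (X i) f' u}].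
  move=> Zs; elim: s => [|u s [Z' [f' [Z's fg fs]]]].
    exists Z, f; split=> //; exists (hid _), (hid _).
    by rewrite /ishom /chain_map !hcomp1l !hcomp1r.
  have [Z'' [h [Z''s hf hu]]] := step i u Z' f' Z's.
  exists Z'', h; split=> //; first exact: ftrans hf fg.
  by move=> v; rewrite inE => /predU1P[->//|/fs]; apply: ftrans.
have stepi i Z f : insum Z ->
    exists Z' f', [/\ insum Z', fac Z' Z f' f & forall u, fac Z' (X i) f' u].
  move=> Zs; have [Z' [f' [Z's ff fU]]] := steps i (vbasis fullv) Z f Zs.
  exists Z', f'; split=> // u; have: u \in fullv by rewrite memvf.
  rewrite -(span_basis (vbasisP fullv)); apply: (@span_ind _ _ (fac Z' (X i) f'))
    => [|k v w|v vU]; last exact: fU.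
    by exists 0, 0; rewrite /ishom /chain_map !(hcomp0r, hcomp0l).
  move=> [u1 [u0 [uc u0E]]] [v1 [v0 [vc v0E]]].
  exists (k *: u1 + v1), (k *: u0 + v0); rewrite /= -u0E -v0E.
  by split; rewrite /ishom /chain_map !hDE ?uc ?vc.
have stepI (s : seq I) : exists Z f, insum Z /\
    {in s, forall i (u : homA P (cpx0 (X i))), fac Z (X i) f u}.
  elim: s => [|i s [Z [f [Zs fs]]]].
    by have [Z Zs] := insum_nil; exists Z, 0.
  have [Z' [f' [Z's ff fi]]] := stepi i Z f Zs.
  exists Z', f'; split=> // j; rewrite inE => /predU1P[-> //|/fs js u].
  exact: ftrans ff (js u).
have [Z [f [Zs fI]]] := stepI (enum I).
by exists Z, f; split=> // i; apply: fI; rewrite mem_enum.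
Qed.

(* The modules N with Hom(X i, N) = Hom(X i, N[1]) = 0 for all i, that is, the
   tau-perpendicular category of the presilting complexes X i. *)
Definition perp N := forall i,
  (forall h : homA (cpx0 (X i)) N, h \oA cpxd (X i) = 0 -> h = 0) /\
  (forall f : homA (cpx1 (X i)) N, exists h, f = h \oA cpxd (X i)).

Hypothesis Xproj : forall i, projective_mod (cpx1 (X i)) /\ projective_mod (cpx0 (X i)).
Hypothesis Xorth : forall i j, orth (X i) (X j).
Hypothesis noperp : forall N, perp N -> hid N = 0.

(** The cokernel [C] of the map [j] with components [g0] and [cpxd Z] satisfies [perp], hence
    vanishes, and maps from projectives to [cpx0 Z] lift through [j]. *)
Lemma generated Z : (forall i, orth (X i) Z) ->
  exists Z' g1 g0, [/\ insum Z', @ishom K A Z' Z g1 g0,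
    forall i w1 w0, @ishom K A (X i) Z w1 w0 -> factors g1 g0 w1 w0 &
    forall P (f : homA P (cpx0 Z)), projective_mod P ->
      exists a b, f = g0 \oA a + cpxd Z \oA b].
Proof.
move=> oZ; have [Z' [g1 [g0 [Z's gc gf]]]] := right_approx Z.
exists Z', g1, g0; split=> //.
pose j := g0 \oA dfst _ _ + cpxd Z \oA dsnd _ _.
have jE M (t : homA M (dsum (cpx0 Z') (cpx1 Z))) :
    j \oA t = g0 \oA (dfst _ _ \oA t) + cpxd Z \oA (dsnd _ _ \oA t).
  by rewrite hcompDl !hcompA.
have [C [p [ps pj pP]]] := coker_ex j.
have pg0 : p \oA g0 = 0.
  transitivity (p \oA j \oA dinl _ _); last by rewrite pj hcomp0l.
  by rewrite -hcompA jE dfst_inl dsnd_inl hcomp0r addr0 hcomp1r.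
have pd : p \oA cpxd Z = 0.
  transitivity (p \oA j \oA dinr _ _); last by rewrite pj hcomp0l.
  by rewrite -hcompA jE dfst_inr dsnd_inr hcomp0r add0r hcomp1r.
suff C0 : hid C = 0.
  move=> P f Pp; have [|t <-] := pP P f Pp; first by rewrite -[p]hcomp1l C0 !hcomp0l.
  by rewrite jE; exists (dfst _ _ \oA t), (dsnd _ _ \oA t).
apply: noperp => i; have [X1p X0p] := Xproj i; split=> [h hd|f].
  have [h' h'E] := proj_lift h X0p ps.
  have [|t tE] := pP _ (h' \oA cpxd (X i)) X1p; first by rewrite hcompA h'E.
  rewrite jE in tE; set a := _ \oA t in tE; set b := _ \oA t in tE.
  (* The component [a] in [Z'] is null-homotopic. Correcting the lift [h'] by this homotopy gives a
     chain map from [X i] to [Z]; it factors through [g], and [p] kills [g0]. *)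
  have [al [be aE]] := insum_orthr (@Xorth i) Z's a.
  have [|u1 [u0 [uc u1E u0E]]] := gf i (b + g1 \oA be) (h' - g0 \oA al).
    rewrite /ishom /chain_map hcompDr hcompBl -tE aE hcompDr !hcompA gc.
    by apply/esym/eqP; rewrite subr_eq addrC -addrA (addrC (_ \oA be)).
  by rewrite -h'E -[h'](subrK (g0 \oA al)) -u0E hcompDr !hcompA pg0 !hcomp0l addr0.
(* A lift of [f] to [cpx0 Z] is null-homotopic by [oZ], and [p] kills the part through [cpxd Z]. *)
have [f' f'E] := proj_lift f X1p ps.
have [h [s hs]] := oZ i f'.
exists (p \oA h); by rewrite -f'E hs hcompDr !hcompA pd hcomp0l addr0.
Qed.

(** The cone [Y] of a left approximation of [P] is shown to be a direct summand of a good complex,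
    by splitting an exact sequence of complexes whose class lies in a vanishing Hom(Y, Z[1]). *)
Lemma mu_proj (V : zmodType) (mu : rmodule A -> V) P :
    (forall M M1 M2 (i1 : homA M1 M) (i2 : homA M2 M) p1 p2,
      p1 \oA i1 = hid M1 -> p2 \oA i2 = hid M2 ->
      i1 \oA p1 + i2 \oA p2 = hid M -> mu M = mu M1 + mu M2) ->
  (forall i, good mu (X i)) -> projective_mod P -> mu P = 0.
Proof.
move=> mu_add Xg Pp; have [W [f [Ws fP]]] := left_approx P.
(* This is the differential of the cone of [f], from the sum of [cpx1 W] and [P] to [cpx0 W]; the
   existential keeps it opaque. *)
have [dY dYE] : {d | d = cpxd W \oA dfst _ P + f \oA dsnd (cpx1 W) P} by eexists.
pose Y := Cplx dY.
have Y1p : projective_mod (cpx1 Y).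
  by apply: dsum_proj => //; have [] := insum_proj Xproj Ws.
have oXY i : orth (X i) Y.
  move=> u; have [h [s uE]] := insum_orthr (@Xorth i) Ws u.
  exists h, (dinl _ _ \oA s); rewrite /= dYE hcompDl -!hcompA.
  rewrite (hcompA (dfst _ _)) (hcompA (dsnd _ _)) dfst_inl dsnd_inl.
  by rewrite hcomp0l hcomp0r hcomp1l addr0.
(* On [cpx1 W] the map [F] is null-homotopic since sums of the [X j] are orthogonal to [X i]; on [P]
   the remaining error extends to a chain map [w] from [W] because [f] is a left approximation. *)
have oYX i : orth Y (X i).
  move=> F; have [h [s hE]] := insum_orthl (fun j => @Xorth j i) Ws (F \oA dinl _ _).
  have [w1 [w0 [wc wE]]] := fP i (F \oA dinr _ _ - h \oA f).
  exists (h + w0), ((s - w1) \oA dfst _ _).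
  rewrite -[LHS]hcomp1r -dsum_id hcompDr !hcompA hE.
  rewrite -[F \oA dinr _ _](subrK (h \oA f)) -wE /= dYE.
  rewrite (hcompBr _ s w1) wc.
  rewrite !hcompDl !hcompNl !hcompDr !hcompA /=.
  rewrite [w0 \oA cpxd W \oA _ + _]addrC [cpxd _ \oA s \oA _ - _]addrC !addrA addrK.
  by rewrite [in LHS]addrAC -!addrA; congr (_ + _); rewrite addrC -!addrA.
have [X' [g1 [g0 [X's gc gf gP]]]] := generated oXY.
(* Adding the identity complex on [cpx1 Y] makes the approximation surjective in both degrees. *)
pose Xc := csum X' (Cplx (hid (cpx1 Y))).
pose q1 : homA (cpx1 Xc) (cpx1 Y) := g1 \oA dfst _ _ + dsnd _ _.
pose q0 : homA (cpx0 Xc) (cpx0 Y) := g0 \oA dfst _ _ + cpxd Y \oA dsnd _ _.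
have qc : ishom q1 q0.
  rewrite /ishom /chain_map /q1 /q0 hcompDr hcompDl hcompA gc -!hcompA csum_dfst.
  by rewrite csum_dsnd hcomp1l.
(* The complex [Z] formed by these two kernels is the kernel of [q]. *)
have [K0 [k0 [k0i qk0 k0u]]] := ker_ex q0.
have [K1 [k1 [k1i qk1 k1u]]] := ker_ex q1.
have [|dZ dZE] := k0u _ (cpxd Xc \oA k1).
  by rewrite hcompA -qc -hcompA qk1 hcomp0r.
pose Z := Cplx dZ.
(* In [Xc] the map [u] is null-homotopic. The homotopy need not have values in the kernel of [q],
   but its image in [Y], up to a sign in degree 1, is a chain map; this factors through [g], and the
   factorisation corrects the homotopy. *)
have oXZ i : orth (X i) Z.
  move=> u; have oX : orth (X i) Xc.
    apply: orth_csumr; first exact: insum_orthr (@Xorth i) X's.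
    by move=> v; exists 0, v; rewrite hcomp0l add0r hcomp1l.
  have [al [be ukE]] := oX (k0 \oA u).
  have [|u1 [u0 [uc u1E u0E]]] := gf i (- (q1 \oA be)) (q0 \oA al).
    rewrite /ishom /chain_map hcompNr hcompA qc; apply/esym/eqP.
    by rewrite -addr_eq0 -!hcompA -hcompDr -ukE hcompA qk0 hcomp0l.
  have qd1 M (t : homA M _) : q1 \oA (dinl _ _ \oA t) = g1 \oA t.
    by rewrite hcompDl -hcompA !(hcompA _ (dinl _ _)) dfst_inl dsnd_inl hcomp0l addr0 hcomp1l.
  have qd0 M (t : homA M _) : q0 \oA (dinl _ _ \oA t) = g0 \oA t.
    rewrite hcompDl -!hcompA !(hcompA _ (dinl _ _)) dfst_inl dsnd_inl hcomp0l.
    by rewrite hcomp0r addr0 hcomp1l.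
  have [|h hE] := k0u _ (al - dinl _ _ \oA u0).
    by rewrite hcompBr qd0 u0E subrr.
  have [|t tE] := k1u _ (dinl _ _ \oA u1 + be).
    by rewrite hcompDr qd1 u1E addNr.
  exists h, t; apply: (hinj_mono k0i); rewrite hcompDr !hcompA hE /= dZE ukE.
  rewrite -(hcompA (cpxd Xc)) tE hcompBl hcompDr (hcompA (cpxd Xc)) csum_dinl.
  by rewrite -!hcompA uc addrA subrK.
have [Z' [l1 [l0 [Z's lc _ lP]]]] := generated oXZ.
(* As [cpx1 Y] is projective, [u] comes from a map to [cpx0 Z'] up to a map through [cpxd Z], and
   [Y] is orthogonal to [Z']. *)
have oYZ : orth Y Z.
  move=> u; have [a [b ->]] := lP _ u Y1p.
  have [h [s ->]] := insum_orthr oYX Z's a.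
  exists (l0 \oA h), (l1 \oA s + b).
  by rewrite !hcompDr !hcompA -lc addrA.
have [_ W0p] := insum_proj Xproj Ws.
have [a [b abE]] := gP _ (hid (cpx0 Y)) W0p.
(* The maps [r0] and [r1] are sections of [q] in each degree. Their failure to form a chain map is a
   map [de] from [cpx1 Y] to [cpx0 Z]; a null-homotopy of [de] turns them into a chain section. *)
pose r0 : homA (cpx0 Y) (cpx0 Xc) := dinl _ _ \oA a + dinr _ _ \oA b.
have qr0 : q0 \oA r0 = hid _.
  rewrite hcompDr hcompDl hcompDl -!hcompA !(hcompA (dfst _ _)) !(hcompA (dsnd _ _)).
  rewrite dfst_inl dfst_inr dsnd_inl dsnd_inr !hcomp0l !hcomp0r !hcomp1l.
  by rewrite addr0 add0r abE.
pose r1 : homA (cpx1 Y) (cpx1 Xc) := dinr _ _.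
have qr1 : q1 \oA r1 = hid _.
  by rewrite hcompDl -hcompA dfst_inr dsnd_inr hcomp0r add0r.
have [|de deE] := k0u _ (cpxd Xc \oA r1 - r0 \oA cpxd Y).
  by rewrite hcompBr !hcompA -qc -hcompA qr1 qr0 hcomp1l hcomp1r subrr.
have [et [th dE]] := oYZ de.
have Ygood : mu (cpx0 Y) = mu (cpx1 Y).
  have gXc : good mu Xc.
    apply: (@good_csum _ _ _ _ mu_add _ _ _ (@good_id _ _ _ _ mu_add _)).
    exact: (@insum_good _ mu _ mu_add Xg X's).
  apply: (gXc Y (r1 - k1 \oA th) (r0 + k0 \oA et) q1 q0).
  - rewrite /ishom /chain_map hcompBr hcompDl.
    have -> : cpxd Xc \oA (k1 \oA th) = k0 \oA (dZ \oA th) by rewrite !hcompA dZE.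
    apply/eqP; rewrite subr_eq -addrA -(hcompA k0) -hcompDr -dE deE addrC.
    by rewrite subrK.
  - exact: qc.
  - by rewrite hcompBr hcompA qk1 hcomp0l subr0.
  - by rewrite hcompDr hcompA qk0 hcomp0l addr0.
(* The function [mu] agrees on the terms of [Y] and on those of [W]; as [cpx0 Y] is [cpx0 W], only
   the contribution of [P] is left. *)
have := mu_dsum mu_add (cpx1 W) P; rewrite -[LHS]/(mu (cpx1 Y)) -Ygood /=.
rewrite (good_self (@insum_good _ mu _ mu_add Xg Ws)) => /eqP.
by rewrite -{1}[mu (cpx1 W)]addr0 (inj_eq (addrI _)) => /eqP.
Qed.

End Approximation.

(** * Dimensions of Hom-spaces *)

Lemma dim_exact (K : fieldType) (U V W : vectType K) (f : 'Hom(U, V)) (g : 'Hom(V, W)) :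
    lker f = 0%VS -> limg f = lker g -> limg g = fullv ->
  \dim (fullv : {vspace V}) = (\dim (fullv : {vspace U}) + \dim (fullv : {vspace W}))%N.
Proof.
move=> f0 fg g1; rewrite -(limg_ker_dim g fullv) capfv -fg g1.
by rewrite -(limg_ker_dim f fullv) capfv f0 dimv0.
Qed.

Section Dimensions.
Variables (K : fieldType) (A : falgType K).
Implicit Types L M N P Q T : rmodule A.

Definition hdim M N := \dim (fullv : {vspace (homA M N)}).

Lemma hdimE M N : hdim M N = \dim (HomA M N).
Proof. by rewrite /hdim dimvf. Qed.

Definition hpre N L M (f : homA L M) : 'Hom(homA M N, homA L N) :=
  linfun (fun g => g \oA f).
Definition hpost L M N (f : homA M N) : 'Hom(homA L M, homA L N) :=
  linfun (fun g => f \oA g).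

Lemma hpreE N L M (f : homA L M) g : hpre N f g = g \oA f.
Proof. by apply: linfun_linearE => k x y; rewrite !hDE. Qed.
Lemma hpostE L M N (f : homA M N) g : hpost L f g = f \oA g.
Proof. by apply: linfun_linearE => k x y; rewrite !hDE. Qed.

Lemma lker_eq0 (U V : vectType K) (f : 'Hom(U, V)) :
  (forall x, f x = 0 -> x = 0) -> lker f = 0%VS.
Proof.
move=> f0; apply/eqP; rewrite -subv0; apply/subvP=> x.
by rewrite memv_ker => /eqP /f0 ->; apply: mem0v.
Qed.

Lemma limg_onto (U V : vectType K) (f : 'Hom(U, V)) :
  (forall y, exists x, f x = y) -> limg f = fullv.
Proof.
move=> fs; apply/eqP; rewrite eqEsubv subvf; apply/subvP=> y _.
by have [x <-] := fs y; apply: memv_img (memvf x).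
Qed.

Lemma limg_lker (U V W : vectType K) (f : 'Hom(U, V)) (g : 'Hom(V, W)) :
    (forall x, g (f x) = 0) -> (forall y, g y = 0 -> exists x, f x = y) ->
  limg f = lker g.
Proof.
move=> gf0 gf; apply/vspaceP=> y; rewrite memv_ker; apply/idP/eqP.
  by case/memv_imgP=> x _ ->.
by case/gf=> x <-; apply: memv_img (memvf x).
Qed.

Lemma hdim_add N M M1 M2 (i1 : homA M1 M) (i2 : homA M2 M) p1 p2 :
    p1 \oA i1 = hid M1 -> p2 \oA i2 = hid M2 -> i1 \oA p1 + i2 \oA p2 = hid M ->
  hdim M N = (hdim M1 N + hdim M2 N)%N.
Proof.
(* The orthogonality of the two summands is forced: composing [ip] with [i1] gives
   [i2 \oA (p2 \oA i1) = 0], and [i2] has a left inverse. *)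
move=> pi1 pi2 ip; have p2i1 : p2 \oA i1 = 0.
  have : (i1 \oA p1 + i2 \oA p2) \oA i1 = i1 by rewrite ip hcomp1l.
  rewrite hcompDl -!hcompA pi1 hcomp1r -[RHS]addr0 => /addrI.
  by move=> /(congr1 (hcomp p2)); rewrite hcompA pi2 hcomp1l hcomp0r.
rewrite addnC; apply: (@dim_exact _ _ _ _ (hpre N p2) (hpre N i1)).
- apply: lker_eq0 => g; rewrite hpreE => /(congr1 (fun h => h \oA i2)).
  by rewrite -hcompA pi2 hcomp1r hcomp0l.
- apply: limg_lker => g; rewrite !hpreE; first by rewrite -hcompA p2i1 hcomp0r.
  move=> gi; exists (g \oA i2); rewrite hpreE -hcompA.
  by rewrite -[RHS]hcomp1r -ip hcompDr !hcompA gi hcomp0l add0r.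
by apply: limg_onto => g; exists (g \oA p1); rewrite hpreE -hcompA pi1 hcomp1r.
Qed.

Lemma hdim_pre N L M (f : homA L M) : (forall g : homA M N, g \oA f = 0 -> g = 0) ->
  (forall g : homA L N, exists h, g = h \oA f) -> hdim M N = hdim L N.
Proof.
(* The space ['rV[K]_0] serves as the zero third term of a short exact sequence. *)
move=> fi fs; apply/esym; rewrite [LHS](@dim_exact _ _ _ _ (hpre N f) (0 : 'Hom(_, 'rV[K]_0))).
- by rewrite [X in (_ + X)%N]dimvf /dim /= muln0 addn0.
- by apply: lker_eq0 => g; rewrite hpreE; apply: fi.
- apply: limg_lker => g; first by rewrite lfunE.
  by move=> _; have [h ->] := fs g; exists h; rewrite hpreE.
by apply: limg_onto => y; exists 0; apply/rowP; case.
Qed.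


Lemma hdim_post P M1 M M2 (i : homA M1 M) (p : homA M M2) :
    projective_mod P -> hinj i -> hsurj p ->
    (forall x, p (i x) = 0) -> (forall y, p y = 0 -> exists x, i x = y) ->
  hdim P M = (hdim P M1 + hdim P M2)%N.
Proof.
move=> Pp ii ps pi ip; apply: (@dim_exact _ _ _ _ (hpost P i) (hpost P p)).
- apply: lker_eq0 => g; rewrite hpostE => ig; apply: (hinj_mono ii).
  by rewrite ig hcomp0r.
- apply: limg_lker => g; rewrite !hpostE.
    by apply: hom_ext => x; rewrite !hE pi.
  move=> pg; have [|h <-] := @factor_inj _ _ _ _ _ i g ii; last first.
    by exists h; rewrite hpostE.
  by move=> x; apply: ip; rewrite -hcompE pg hE.
apply: limg_onto => g; have [h <-] := proj_lift g Pp ps.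
by exists h; rewrite hpostE.
Qed.

Lemma nonzeroP M : hid M <> 0 <-> nonzero_mod M.
Proof.
split=> [M0 | /eqP M0 h0]; last first.
  apply/M0/eqP; rewrite -subv0; apply/subvP=> x _.
  by rewrite -[x]hidE h0 hE mem0v.
apply/eqP => f0; apply: M0; apply: hom_ext => x.
by rewrite !hE; apply/eqP; rewrite -memv0 -f0 memvf.
Qed.

Lemma hsurj_hinj M (f : homA M M) : hsurj f -> hinj f.
Proof.
move=> /hsurjP fs; apply/hinjP; rewrite /injectiveA; apply/eqP.
rewrite -dimv_eq0; have := limg_ker_dim (vsval f) fullv.
by rewrite fs capfv => /eqP; rewrite -[X in _ == X]add0n eqn_add2r.
Qed.

Lemma simple_inj S M (f : homA S M) : simple_mod S -> f <> 0 -> hinj f.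
Proof.
move=> [_ S0] f0; apply/hinjP; have [//|ff] := S0 _ (@hker_submod _ _ _ _ f).
case: f0; apply: hom_ext => x; rewrite hE; apply/eqP.
by rewrite -/(happ f) -memv_ker ff memvf.
Qed.

Lemma simple_surj S M (f : homA M S) : simple_mod S -> f <> 0 -> hsurj f.
Proof.
move=> [_ S0] f0; apply/hsurjP; have [ff|//] := S0 _ (@himg_submod _ _ _ _ f).
case: f0; apply: hom_ext => x; rewrite hE; apply/eqP.
by rewrite -memv0 -ff; apply: memv_img (memvf x).
Qed.

Lemma isoAP M N : isoA M N <->
  exists (f : homA M N) (g : homA N M), g \oA f = hid M /\ f \oA g = hid N.
Proof.
split=> [[f [g [fA gA gf fg]]] | [f [g [gf fg]]]].
  exists (mkhom fA), (mkhom gA); split; apply: hom_ext => x; rewrite !hE !mkhomE.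
    by rewrite -comp_lfunE gf id_lfunE.
  by rewrite -comp_lfunE fg id_lfunE.
exists (vsval f), (vsval g); split; try exact: subvsP; apply/lfunP=> x.
  by rewrite comp_lfunE id_lfunE -[RHS](hidE) -gf hE.
by rewrite comp_lfunE id_lfunE -[RHS](hidE) -fg hE.
Qed.

Lemma simple_iso S T (f : homA S T) : simple_mod S -> simple_mod T -> f <> 0 -> isoA S T.
Proof.
move=> Ss Ts f0; have [g [fg gf]] := hbij_inv (simple_inj Ss f0) (simple_surj Ts f0).
by apply/isoAP; exists f, g.
Qed.

Lemma hdim_simple S T : simple_mod S -> simple_mod T -> ~ isoA S T -> hdim S T = 0%N.
Proof.
move=> Ss Ts ST; apply/eqP; rewrite dimv_eq0 -subv0; apply/subvP=> f _.
have [->|f0] := eqVneq f 0; first exact: mem0v.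
by case: ST; apply: simple_iso Ss Ts (elimN eqP f0).
Qed.

Lemma hdim_simple_gt0 S : simple_mod S -> (0 < hdim S S)%N.
Proof.
case=> /nonzeroP S0 _; rewrite lt0n dimv_eq0; apply/eqP=> f0; apply: S0.
by apply/eqP; rewrite -memv0 -f0 memvf.
Qed.

(** Otherwise [f] maps the kernel of [p] onto the simple module [T], the kernels of [f] and [p]
    together span [P], and superfluity forces [f] to vanish. *)
Lemma cover_ker P S T (p : homA P S) (f : homA P T) :
    simple_mod T -> superfluous (lker (vsval p)) -> f <> 0 ->
  forall x, p x = 0 -> f x = 0.
Proof.
move=> [T0 Ts] ps f0 x px; pose U := (vsval f @: lker (vsval p))%VS.
have Us : is_submod U.
  move=> a _ /memv_imgP[y yp ->]; rewrite -[vsval f y]/(f y) -happA.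
  by apply/memv_img/hker_submod.
have [U0|U1] := Ts U Us.
  by apply/eqP; rewrite -memv0 -U0; apply: memv_img; rewrite memv_ker; apply/eqP.
case: f0; apply: hom_ext => y; rewrite hE; apply/eqP.
rewrite -[happ f y]/(vsval f y) -memv_ker.
rewrite (ps _ (@hker_submod _ _ _ _ f)) ?memvf //.
apply/eqP; rewrite eqEsubv subvf; apply/subvP=> z _.
have: vsval f z \in U by rewrite U1 memvf.
case/memv_imgP=> w wp fzw; apply/memv_addP; exists (z - w).
  by rewrite memv_ker raddfB /= fzw subrr.
by exists w; rewrite // subrK.
Qed.

Lemma hdim_cover P S T (p : homA P S) :
    simple_mod T -> hsurj p -> superfluous (lker (vsval p)) ->
  hdim P T = hdim S T.
Proof.
move=> Ts ps sp; apply/esym/(@hdim_pre _ _ _ p) => [g gp|g].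
  by apply: hom_ext => y; have [x <-] := ps y; rewrite -hcompE gp !hE.
have [->|/eqP g0] := eqVneq g 0; first by exists 0; rewrite hcomp0l.
by have [h <-] := factor_surj ps (cover_ker Ts sp g0); exists h.
Qed.

End Dimensions.

(** * Bricks, composition series and pairings with projectives *)

Section Bricks.
Variables (K : fieldType) (A : falgType K).
Implicit Types L M N P Q T : rmodule A.

(** The image of an endomorphism is both a quotient and a submodule of [N], which is the form given
    to the closure condition on [W]. In a nonzero object of least dimension a nonzero endomorphism
    is therefore surjective, hence bijective. *)
Lemma brick_exists (W : rmodule A -> Prop) :
    (forall N J (e : homA N J) (i : homA J N), W N -> hsurj e -> hinj i -> W J) ->
  (exists2 N, W N & hid N <> 0) -> exists2 B, W B & brick B.
Proof.
move=> Wim [N WN N0]; have [d] := ubnP (\dim (fullv : {vspace N})).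
elim: d N WN N0 => // d IHd N WN N0 Nd.
have [[N' [WN' N'0 N'N]] | Nmin] := classic (exists N', [/\ W N', hid N' <> 0 &
  (\dim (fullv : {vspace N'}) < \dim (fullv : {vspace N}))%N]).
  exact: (IHd N' WN' N'0 (leq_trans N'N Nd)).
exists N => //; split; first exact/nonzeroP.
move=> f0 f0A f0n; pose f := mkhom f0A.
have fE : vsval f = f0 by rewrite vsprojK.
pose Js := @himg_submod _ _ _ _ f.
have [e eE] : exists e, submi Js \oA e = f.
  apply: factor_inj (@submi_inj _ _ _ _ Js) _ => x.
  by apply: submi_onto; apply: memv_img (memvf x).
have es : hsurj e.
  move=> y; have /memv_imgP[x _ yx] := submi_mem y.
  by exists x; apply: (hinj_eq (@submi_inj _ _ _ _ Js)); rewrite -hcompE eE yx.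
have WJ : W (subm Js) by apply: Wim WN es (@submi_inj _ _ _ _ Js).
have J0 : hid (subm Js) <> 0.
  move=> J0; move/eqP: f0n; apply; rewrite -fE -eE -[e]hcomp1l J0 hcomp0l hcomp0r.
  by rewrite raddf0.
have fs : hsurj f.
  apply/hsurjP; apply/eqP; rewrite eqEdim subvf /= leqNgt; apply/negP => lt.
  by apply: Nmin; exists (subm Js); split; rewrite ?dim_subm.
have [g [fg gf]] := hbij_inv (hsurj_hinj fs) fs.
exists (vsval g); split; first exact: subvsP.
  apply/lfunP=> x; rewrite comp_lfunE -fE -[vsval g _]/(g (f x)).
  by rewrite -hcompE gf !(hidE, id_lfunE).
apply/lfunP=> x; rewrite comp_lfunE -fE -[vsval f _]/(f (g x)).
by rewrite -hcompE fg !(hidE, id_lfunE).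
Qed.

(** The first half of [perp] passes to submodules and the second to quotients, by projectivity of
    the degree 1 terms; [J] is both. *)
Lemma perp_image (I : finType) (X : I -> cplx A) N J (e : homA N J) (i : homA J N) :
    (forall j, projective_mod (cpx1 (X j))) ->
  perp X N -> hsurj e -> hinj i -> perp X J.
Proof.
move=> Xp WN es ii j; have [WN1 WN2] := WN j; split=> [h hd|f].
  apply: (hinj_mono ii); rewrite hcomp0r; apply: WN1.
  by rewrite -hcompA hd hcomp0r.
have [f' <-] := proj_lift f (Xp j) es.
by have [h ->] := WN2 f'; exists (e \oA h); rewrite hcompA.
Qed.

Lemma max_submod M : nonzero_mod M -> exists U : {vspace M},
  [/\ is_submod U, U <> fullv &
      forall V : {vspace M}, is_submod V -> (U <= V)%VS -> V = U \/ V = fullv].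
Proof.
move=> M0; pose proper (U : {vspace M}) := is_submod U /\ U <> fullv.
suff step d (U : {vspace M}) : proper U -> (\dim (fullv : {vspace M}) - \dim U < d)%N ->
    exists U, proper U /\
      forall V : {vspace M}, is_submod V -> (U <= V)%VS -> V = U \/ V = fullv.
  have [||U [[Us U1] Um]] := step (\dim (fullv : {vspace M})).+1 0%VS.
  - split; first by move=> a x; rewrite !memv0 => /eqP ->; rewrite linear0.
    by move=> M00; rewrite /nonzero_mod -M00 eqxx in M0.
  - by rewrite dimv0 subn0.
  by exists U.
elim: d U => // d IHd U pU dU.
have [[V [pV UV VU]] | Um] := classic (exists V, [/\ proper V, (U <= V)%VS & V <> U]).
  apply: (IHd V pV); have ltUV : (\dim U < \dim V)%N.
    rewrite ltnNge; apply/negP => le; apply: VU; apply/esym/eqP.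
    by rewrite eqEdim UV.
  have leV := dimvS (subvf V).
  by rewrite ltnS in dU; apply: leq_trans dU; rewrite ltn_sub2l // (leq_trans ltUV).
exists U; split=> // V Vs UV; have [->|VU] := classic (V = U); first by left.
by right; apply: NNPP => V1; apply: Um; exists V.
Qed.

Section Family.
Variables (n : nat) (S P : 'I_n -> rmodule A).

(** A maximal proper submodule has a simple quotient; recursion on the dimension builds the
    series. *)
Lemma K0_exists : complete_simples S -> forall M, exists v, K0_class S M v.
Proof.
move=> [S1 S2 S3] M; have [d] := ubnP (\dim (fullv : {vspace M})).
elim: d M => // d IHd M Md.
have [M0|M0] := classic (nonzero_mod M); last by exists 0; apply: K0_class0.
have [U [Us U1 Um]] := max_submod M0.
have [N [p [ps pU]]] := quot_ex Us.
have Ns : simple_mod N.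
  split.
    apply/nonzeroP => N0; apply: U1; apply/eqP; rewrite eqEsubv subvf.
    by apply/subvP=> x _; rewrite -pU -[p x]hidE N0 hE.
  move=> V Vs; pose V' := (vsval p @^-1: V)%VS.
  have V's : is_submod V'.
    move=> a x; rewrite -!memv_preim => xV.
    by rewrite -[vsval p _]/(p _) happA; apply: Vs.
  have [|VU|V1] := Um V' V's.
  - apply/subvP=> x; rewrite -memv_preim -pU => /eqP px.
    by rewrite -[vsval p x]/(p x) px mem0v.
  - left; apply/eqP; rewrite -subv0; apply/subvP=> y yV.
    have [x xy] := ps y; rewrite memv0 -xy pU -VU -memv_preim.
    by rewrite -[vsval p x]/(p x) xy.
  right; apply/eqP; rewrite eqEsubv subvf; apply/subvP=> y _.
  have [x <-] := ps y; have: x \in V' by rewrite V1 memvf.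
  by rewrite -memv_preim.
have [i /isoAP[f [g [gf fg]]]] := S3 N Ns.
have [|v Lv] := IHd (subm Us).
  rewrite dim_subm; rewrite ltnS in Md; apply: leq_trans Md; rewrite ltnNge.
  by apply/negP => le; apply: U1; apply/eqP; rewrite eqEdim subvf.
exists (v + delta_mx i 0).
apply: (@K0_classS _ _ _ _ _ _ _ _ (vsval (submi Us)) (vsval (f \oA p))) => //.
- exact: subvsP.
- exact: subvsP.
- exact/hinjP/submi_inj.
- apply/vspaceP=> x; rewrite memv_ker -[vsval (f \oA p) x]/((f \oA p) x) hE.
  apply/memv_imgP/eqP => [[u _ ->]|fp].
    have /eqP -> : p (vsval (submi Us) u) == 0 by rewrite pU submi_mem.
    by rewrite raddf0.
  have [|u ux] := @submi_onto _ _ _ _ Us x; last by exists u; rewrite ?memvf.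
  by rewrite -pU -[p x]hidE -gf hE fp raddf0.
- apply/hsurjP => y; have [x xy] := ps (g y); exists x.
  by rewrite hE xy -hcompE fg hE.
Qed.

Lemma K0_class_ge0 M v : K0_class S M v ->
  (forall i, 0 <= v i 0) /\ (nonzero_mod M -> v <> 0).
Proof.
elim=> [{}M M0|L {}M i {}v f g _ _ _ _ _ _ [v0 _]].
  by split=> [j|]; rewrite ?mxE.
split=> [j|_]; first by rewrite !mxE addr_ge0.
move/matrixP/(_ i 0); rewrite !mxE !eqxx => /eqP.
by rewrite paddr_eq0 // andbF.
Qed.

(** Hom out of a projective is exact, so dimensions add up along a composition series. *)
Lemma hdim_K0 Q M v : projective_mod Q -> K0_class S M v ->
  (hdim Q M)%:Z = \sum_i v i 0 * (hdim Q (S i))%:Z.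
Proof.
move=> Qp; elim=> [{}M M0|L {}M i {}v f g fA gA fi fg gs _ IH].
  rewrite big1 => [|i _]; last by rewrite mxE mul0r.
  congr Posz; apply/eqP; rewrite dimv_eq0 -subv0; apply/subvP=> h _.
  suff -> : h = 0 by exact: mem0v.
  apply: NNPP => h0; apply: M0; apply/nonzeroP => M0; apply: h0.
  by rewrite -[h]hcomp1l M0 hcomp0l.
have fE : vsval (mkhom fA) = f by rewrite vsprojK.
have gE : vsval (mkhom gA) = g by rewrite vsprojK.
have <- : (hdim Q L + hdim Q (S i))%N = hdim Q M.
  apply/esym/(@hdim_post _ _ _ _ _ _ (mkhom fA) (mkhom gA)) => //.
  - by apply/hinjP; rewrite fE.
  - by apply/hsurjP; rewrite gE.
  - by move=> x; apply/eqP; rewrite mkhomE -memv_ker -fg mkhomE; apply: memv_img (memvf x).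
  - move=> y; rewrite mkhomE => /eqP; rewrite -memv_ker -fg => /memv_imgP[x _ ->].
    by exists x; rewrite mkhomE.
rewrite PoszD IH.
have -> : (hdim Q (S i))%:Z = \sum_j (delta_mx i 0 : 'cV[int]_n) j 0 * (hdim Q (S j))%:Z.
  rewrite (bigD1 i) //= big1 => [|j ji]; rewrite mxE !eqxx ?andbT; last first.
    by rewrite (negPf ji) mul0r.
  by rewrite mul1r addr0.
by rewrite -big_split; apply: eq_bigr => j _; rewrite [in RHS]mxE mulrDl.
Qed.

Hypothesis hS : complete_simples S.
Hypothesis hP : projective_covers S P.

Lemma covers_proj i : projective_mod (P i).
Proof. by have [p [Pp _ _ _]] := hP i. Qed.

Lemma hdim_PS i j : hdim (P i) (S j) = if i == j then hdim (S i) (S i) else 0%N.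
Proof.
have [S1 S2 _] := hS; have [p0 [Pp pA p1 sp]] := hP i; pose p := mkhom pA.
have pE : vsval p = p0 by rewrite vsprojK.
rewrite (@hdim_cover _ _ _ _ _ p) ?pE //; last by apply/hsurjP; rewrite pE.
case: eqP => [-> //|ij]; apply: hdim_simple => //.
by move/S2.
Qed.

(** The right-hand side is the [i]-th entry of [D_mx S *m v]: the matrix of the theorem enters
    through the pairing with the indecomposable projectives. *)
Lemma hdim_PK0 i M v : K0_class S M v ->
  (hdim (P i) M)%:Z = (hdim (S i) (S i))%:Z * v i 0.
Proof.
move=> Mv; rewrite (hdim_K0 (@covers_proj i) Mv) (bigD1 i) //= big1.
  by rewrite hdim_PS eqxx addr0 mulrC.
by move=> j ji; rewrite hdim_PS eq_sym (negPf ji) mulr0.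
Qed.

(** Precomposition with the projections embeds the spaces of maps from the [X i] to [N], and their
    images [U i] decompose the space of maps from [M] to [N]. *)
Lemma is_direct_sum_additive (I : finType) (X : I -> rmodule A) M N :
  is_direct_sum M X -> hdim M N = (\sum_i hdim (X i) N)%N.
Proof.
case=> inj0 [prj0 [ipA pi pi0 ip]].
pose inj i := mkhom (proj1 (ipA i)); pose prj i := mkhom (proj2 (ipA i)).
have pI i : prj i \oA inj i = hid _.
  by apply: hom_ext => x; rewrite !hE !mkhomE -comp_lfunE pi id_lfunE.
have pI0 i j : i != j -> prj j \oA inj i = 0.
  by move=> ij; apply: hom_ext => x; rewrite !hE !mkhomE -comp_lfunE pi0 // zero_lfunE.
have IP : \sum_i inj i \oA prj i = hid M.
  apply: hom_ext => x; rewrite hidE -[RHS](id_lfunE x) -ip sum_lfunE.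
  rewrite (big_morph (fun f : homA M M => f x) (fun f g => haddE f g x) (hzeroE M x)).
  by apply: eq_bigr => i _; rewrite hE !mkhomE comp_lfunE.
pose U i := limg (hpre N (prj i)).
have dU i : \dim (U i) = hdim (X i) N.
  apply/limg_dim_eq; rewrite capfv; apply: lker_eq0 => g; rewrite hpreE => gp.
  by rewrite -[g]hcomp1r -(pI i) hcompA gp hcomp0l.
have dxU : directv (\sum_i U i).
  apply/directv_sum_independent => u uU u0 i _.
  have ud j : u j \oA inj j \oA prj j = u j.
    have /memv_imgP[g _ ->] := uU j isT; rewrite hpreE -!hcompA.
    by rewrite (hcompA (prj j)) pI hcomp1l.
  have uij j : j != i -> u j \oA inj i = 0.
    by move=> ji; rewrite -ud -!hcompA pI0 1?eq_sym // !hcomp0r.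
  have := congr1 (fun g => g \oA inj i \oA prj i) u0.
  rewrite !hcomp_suml (bigD1 i) //= big1 => [|j /uij ->]; last by rewrite hcomp0l.
  by rewrite ud addr0 !hcomp0l.
rewrite /hdim -(eq_bigr _ (fun i _ => dU i)) -(directvP dxU) /=.
suff -> : (\sum_i U i)%VS = fullv by [].
apply/eqP; rewrite eqEsubv subvf; apply/subvP=> g _.
rewrite -[g]hcomp1r -IP hcomp_sumr; apply: memv_sumr => i _.
by rewrite hcompA -hpreE; apply: memv_img (memvf _).
Qed.

Lemma hdim_mult Q N (a : 'I_n -> nat) :
  has_multiplicities P Q a -> hdim Q N = (\sum_i a i * hdim (P i) N)%N.
Proof.
move=> /is_direct_sum_additive ->.
have -> : (\sum_i a i * hdim (P i) N = \sum_i \sum_(j < a i) hdim (P i) N)%N.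
  by apply: eq_bigr => i _; rewrite sum_nat_const card_ord.
by rewrite sig_big_dep.
Qed.

End Family.
End Bricks.

(** * From tau-rigidity to the vanishing of maps X -> N[1]; minimal presentations *)

Section TauRigid.
Variables (K : fieldType) (A : falgType K).
Implicit Types L M N P Q T : rmodule A.

Definition evA M (x : M) : homA (regular_mod A) M.
Proof.
apply: sval (@hom_of _ _ (regular_mod A) M (fun a : A => ract M a x) _ _).
  by move=> k a b; rewrite ract_linear add_lfunE scale_lfunE.
by move=> a b; rewrite /= lfunE /= ractM comp_lfunE.
Defined.

Lemma evAE M (x : M) a : evA x a = ract M a x.
Proof. by rewrite /evA; case: hom_of. Qed.

Lemma evA_linear M k (x y : M) : evA (k *: x + y) = k *: evA x + evA y.
Proof. by apply: hom_ext => a; rewrite !hE !evAE linearP. Qed.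

Lemma hcomp_evA M N (f : homA M N) x : f \oA evA x = evA (f x).
Proof. by apply: hom_ext => a; rewrite !hE !evAE happA. Qed.

Lemma free_cover Q N (s : seq N) : exists F (p : homA F N),
  {in s, forall x, exists y, p y = x} /\
  forall M (f : homA N M) (g : homA Q F) (psi : 'Hom(homA Q M, K^o)),
    (forall x (h : homA Q (regular_mod A)), psi (evA x \oA h) = 0) ->
    psi (f \oA p \oA g) = 0.
Proof.
elim: s => [|x s [F [p [ps pF]]]].
  have [Z Z0] := zero_mod_ex A; exists Z, 0; split=> // M f g psi _.
  by rewrite hcomp0r hcomp0l linear0.
exists (dsum (regular_mod A) F), (evA x \oA dfst _ _ + p \oA dsnd _ _); split.
  move=> y; rewrite inE => /predU1P[->|/ps[z <-]].
    exists (dinl (regular_mod A) F (1 : A)); rewrite !hE !dE /= evAE ract1 id_lfunE.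
    by rewrite raddf0 addr0.
  by exists (dinr _ _ z); rewrite !hE !dE /= raddf0 add0r.
move=> M f g psi psi0; rewrite hcompDr hcompDl linearD /=.
rewrite hcompA hcomp_evA -hcompA psi0 add0r hcompA -hcompA.
exact: pF.
Qed.

(** Dual basis lemma: the identity of a projective factors through a free module, so every map out
    of it is a sum of maps through the regular module. *)
Lemma proj_dual_basis P M (psi : 'Hom(homA P M, K^o)) : projective_mod P ->
    (forall x (h : homA P (regular_mod A)), psi (evA x \oA h) = 0) ->
  forall f, psi f = 0.
Proof.
move=> Pp psi0 f; have [F [p [ps pF]]] := @free_cover P P (vbasis (fullv : {vspace P})).
have p1 : hsurj p.
  apply/hsurjP/eqP; rewrite eqEsubv subvf -(span_basis (vbasisP fullv)) /=.
  apply/span_subvP => x /ps[y <-]; exact: memv_img (memvf y).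
have [g pg] := proj_lift (hid P) Pp p1.
by rewrite -[f]hcomp1r -pg hcompA; apply: pF.
Qed.

(* Hom_A(M, nu P) is the K-dual of Hom_A(P, M) for P projective: a linear form
   psi on Hom_A(P1, M) which vanishes on the maps factoring through d1 is a
   morphism from M to the kernel of nu d1, that is, to tau M. *)
Lemma tau_rigid_ext M : tau_rigid M ->
  exists P1 P0 (d1 : homA P1 P0) (d0 : homA P0 M),
    minimal_presentation (vsval d1) (vsval d0) /\
    forall f : homA P1 M, exists h, f = h \oA d1.
Proof.
case=> T [P1 [P0 [d1 [d0 [i0 [mp iA ii ik]]]]]] MT0.
have [[Pp0 d0A _ _] [Pp1 d1A _ _]] := mp.
pose e1 := mkhom d1A; pose e0 := mkhom d0A; pose i := mkhom iA.
have e1E : vsval e1 = d1 by rewrite vsprojK.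
have e0E : vsval e0 = d0 by rewrite vsprojK.
exists P1, P0, e1, e0; split; first by rewrite e1E e0E.
pose U := limg (hpre M e1).
suff UT (f : homA P1 M) : f \in U.
  move=> f; have /memv_imgP[h _ ->] := UT f.
  by exists h; rewrite hpreE.
have psi0 (psi : 'Hom(homA P1 M, K^o)) :
    (forall h, psi (h \oA e1) = 0) -> forall f, psi f = 0.
  move=> psiU; apply: proj_dual_basis => // x h.
  pose phi (x : M) : nakayama P1 :=
    linfun (fun h : dualA P1 => psi (evA x \oA (h : homA P1 (regular_mod A)))).
  have phiE y (k : dualA P1) :
      phi y k = psi (evA y \oA (k : homA P1 (regular_mod A))).
    by apply: linfun_linearE => c u v; rewrite hcompDr hcompZr linearP.
  have phil : linear phi.
    move=> c u v; apply/lfunP=> k; rewrite add_lfunE scale_lfunE !phiE.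
    by rewrite evA_linear hcompDl hcompZl linearP.
  have phiA a y : phi (ract M a y) = ract (nakayama P1) a (phi y).
    rewrite /= nakayama_actE; apply/lfunP=> k; rewrite comp_lfunE !phiE.
    congr (psi _); apply: hom_ext => z; rewrite !hE !evAE /happ dualA_actE.
    by rewrite comp_lfunE lfunE /= ractM comp_lfunE.
  have [Phi PhiE] := hom_of phil phiA.
  have [||Phi' PhiE'] := @factor_inj _ _ _ _ _ i Phi.
  - by apply/hinjP; rewrite vsprojK.
  (* Since [psi] kills the maps through [d1], [Phi] takes its values in the kernel of
     [nakayama_hom d1], that is, in the image of [T]. *)
  - move=> y; have : Phi y \in limg i0.
      rewrite ik memv_ker nakayama_homE; apply/eqP/lfunP=> k.
      rewrite comp_lfunE zero_lfunE PhiE phiE.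
      suff -> : (dualA_hom d1 k : homA P1 (regular_mod A)) =
                (k : homA P0 (regular_mod A)) \oA e1 by rewrite hcompA psiU.
      apply: hom_ext => z; rewrite hE mkhomE /happ dualA_homE // comp_lfunE //.
    by case/memv_imgP=> t _ ->; exists t; rewrite mkhomE.
  have Phi0 : Phi' = 0.
    have sub0 : (HomA M T <= 0)%VS by rewrite MT0.
    apply: val_inj; apply/eqP; rewrite -memv0.
    exact: (subvP sub0 _ (subvsP Phi')).
  by rewrite -phiE -PhiE -PhiE' Phi0 hcomp0r hE zero_lfunE.
(* The coordinates of [f - projv U f] are linear forms in [f] vanishing on [U], so [psi0] makes them
   all zero. *)
suff /subr0_eq -> : f - projv U f = 0 by apply: memv_proj.
pose b := vbasis (fullv : {vspace (homA P1 M)}).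
rewrite (coord_vbasis (memvf (f - projv U f))) big1 // => j _.
pose psi : 'Hom(homA P1 M, K^o) := linfun (fun g => coord b j (g - projv U g) : K^o).
have psiE g : psi g = coord b j (g - projv U g).
  apply: linfun_linearE => c u v.
  by rewrite (linearP (projv U)) opprD addrACA -scalerBr linearP.
rewrite -psiE psi0 ?scale0r // => h; rewrite psiE projv_id ?subrr ?linear0 //.
by rewrite -hpreE; apply: memv_img (memvf h).
Qed.

Record minpres M (X : cplx A) (d0 : homA (cpx0 X) M) : Prop := Minpres {
  mp_proj1 : projective_mod (cpx1 X);
  mp_proj0 : projective_mod (cpx0 X);
  mp_surj : hsurj d0;
  mp_comp0 : d0 \oA cpxd X = 0;
  mp_im : forall x, d0 x = 0 -> exists y, cpxd X y = x;
  mp_sup0 : superfluous (lker (vsval d0));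
  mp_sup1 : superfluous (lker (vsval (cpxd X)))
}.

Lemma minpresP M P1 P0 (d1 : homA P1 P0) (d0 : homA P0 M) :
  minimal_presentation (vsval d1) (vsval d0) -> @minpres M (Cplx d1) d0.
Proof.
case=> [[p0 _ s0 k0] [p1 _ s1 k1]]; split=> //=; first exact/hsurjP.
  apply: hom_ext => x; rewrite !hE; apply/eqP.
  by rewrite -[d0 _]/(vsval d0 _) -memv_ker -s1; apply: memv_img (memvf x).
move=> x /eqP; rewrite -[d0 _]/(vsval d0 _) -memv_ker -s1 => /memv_imgP[y _ ->].
by exists y.
Qed.

Lemma mp_lift M X (d0 : homA (cpx0 X) M) P (g : homA P (cpx0 X)) :
  minpres d0 -> projective_mod P -> d0 \oA g = 0 -> exists h, cpxd X \oA h = g.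
Proof.
move=> mp Pp dg; apply: proj_lift_img => // x; apply: (mp_im mp).
by rewrite -hcompE dg hE.
Qed.

Lemma superfluous_surj P N (q : homA P N) (u : homA P P) :
  superfluous (lker (vsval q)) -> q \oA u = 0 -> hsurj (hid P + u).
Proof.
move=> sq qu; apply/hsurjP/sq; first exact: himg_submod.
apply/eqP; rewrite eqEsubv subvf; apply/subvP=> x _.
apply/memv_addP; exists (happ (hid P + u) x); first exact: memv_img (memvf x).
exists (- u x); last by rewrite !hE addrK.
rewrite memv_ker -[vsval q _]/(q _) raddfN /=.
by rewrite -hcompE qu hE oppr0.
Qed.

(** The complement [hid P - e] is surjective, and [e] kills its image. *)
Lemma superfluous_idem P N (q : homA P N) (e : homA P P) :
  superfluous (lker (vsval q)) -> q \oA e = 0 -> e \oA e = e -> e = 0.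
Proof.
move=> sq qe ee; have qe' : q \oA (- e) = 0 by rewrite hcompNr qe oppr0.
have s := superfluous_surj sq qe'; apply: hom_ext => y; have [x <-] := s y.
by rewrite -hcompE hcompDr hcompNr hcomp1r ee subrr !hE.
Qed.

Lemma indec_idem M (e : homA M M) : indecomposable M -> e \oA e = e ->
  e = 0 \/ e = hid M.
Proof.
move=> [_ Mi] ee.
have [||e0|e1] := Mi _ _ (@himg_submod _ _ _ _ e) (@hker_submod _ _ _ _ e).
- apply/eqP; rewrite eqEsubv subvf; apply/subvP=> x _; apply/memv_addP.
  exists (e x); first exact: memv_img (memvf x).
  exists (x - e x); last by rewrite addrC subrK.
  by rewrite memv_ker -[vsval e _]/(e _) raddfB /= -hcompE ee subrr.
- apply/eqP; rewrite -subv0; apply/subvP=> x /memv_capP[/memv_imgP[y _ ->]].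
  by rewrite memv_ker -[vsval e (_ _)]/(e (e y)) -hcompE ee memv0.
- left; apply: hom_ext => x; rewrite hE; apply/eqP; rewrite -memv0 -e0.
  exact: memv_img (memvf x).
right; apply: hom_ext => x; rewrite hidE; apply/esym/subr0_eq/eqP.
by rewrite -memv0 -e1 memv_ker -[vsval e _]/(e _) raddfB /= -hcompE ee subrr.
Qed.

(** The idempotent [eM] induced on [M] is zero or the identity. If it is zero, superfluity of the
    two kernels kills [e0] and then [e1]; otherwise the same argument applies to the complementary
    idempotents. *)
Lemma minpres_idem M X (d0 : homA (cpx0 X) M) e1 e0 :
    minpres d0 -> indecomposable M -> @ishom _ _ X X e1 e0 ->
    e1 \oA e1 = e1 -> e0 \oA e0 = e0 ->
  (e1 = 0 /\ e0 = 0) \/ (e1 = hid _ /\ e0 = hid _).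
Proof.
move=> mp Mi.
have aux f1 f0 : @ishom _ _ X X f1 f0 -> f1 \oA f1 = f1 -> f0 \oA f0 = f0 ->
    d0 \oA f0 = 0 -> f1 = 0 /\ f0 = 0.
  move=> fc ff1 ff0 df; have f00 := superfluous_idem (mp_sup0 mp) df ff0.
  split=> //; apply: superfluous_idem (mp_sup1 mp) _ ff1.
  by rewrite fc f00 hcomp0l.
move=> ec ee1 ee0.
have [|eM eME] := @factor_surj _ _ _ _ _ d0 (d0 \oA e0) (mp_surj mp).
  move=> x /(mp_im mp)[y <-]; rewrite -hcompE -hcompA -ec hcompA (mp_comp0 mp).
  by rewrite hcomp0l hE.
have eMM : eM \oA eM = eM.
  apply: hom_ext => y; have [x <-] := mp_surj mp y.
  by rewrite -!hcompE -hcompA eME hcompA eME -hcompA ee0.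
have [eM0|eM1] := indec_idem Mi eMM; [left | right].
  by apply: aux => //; rewrite -eME eM0 hcomp0l.
have idem N (f : homA N N) : f \oA f = f -> (hid N - f) \oA (hid N - f) = hid N - f.
  by move=> ff; rewrite !(hcompBl, hcompBr) !hcomp1l hcomp1r ff subrr subr0.
have [||||/subr0_eq <- /subr0_eq <- //] := aux (hid _ - e1) (hid _ - e0).
- by rewrite /ishom /chain_map hcompBr hcompBl ec hcomp1l hcomp1r.
- exact: idem.
- exact: idem.
- by rewrite hcompBr hcomp1r -eME eM1 hcomp1l subrr.
Qed.

(** This is [orth] with second complex the module [N] placed in degree 0. *)
Definition exts X N := forall f : homA (cpx1 X) N, exists h, f = h \oA cpxd X.

(** The maps [j] and [r] lift to chain maps [a] and [b] whose composite is homotopic to the identity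
    through [s]. By minimality the corrected composite [v] is invertible, so that an extension for
    [f \oA w \oA b1] yields one for [f]. *)
Lemma exts_summand M X (d0 : homA (cpx0 X) M) M' X' (d0' : homA (cpx0 X') M')
    (j : homA M' M) (r : homA M M') N :
  minpres d0 -> minpres d0' -> r \oA j = hid M' -> exts X N -> exts X' N.
Proof.
move=> mp mp' rj eX f.
have [a0 a0E] := proj_lift (j \oA d0') (mp_proj0 mp') (mp_surj mp).
have [|a1 a1E] := mp_lift (g := a0 \oA cpxd X') mp (mp_proj1 mp').
  by rewrite hcompA a0E -hcompA (mp_comp0 mp') hcomp0r.
have [b0 b0E] := proj_lift (r \oA d0) (mp_proj0 mp) (mp_surj mp').
have [|b1 b1E] := mp_lift (g := b0 \oA cpxd X) mp' (mp_proj1 mp).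
  by rewrite hcompA b0E -hcompA (mp_comp0 mp) hcomp0r.
have [|s sE] := mp_lift (g := b0 \oA a0 - hid _) mp' (mp_proj0 mp').
  by rewrite hcompBr hcompA b0E -hcompA a0E hcompA rj hcomp1l hcomp1r subrr.
pose v := b1 \oA a1 - s \oA cpxd X'.
have vs : hsurj v.
  rewrite -[v](subrK (hid _)) addrC; apply: superfluous_surj (mp_sup1 mp') _.
  rewrite !hcompBr hcomp1r !hcompA b1E sE -hcompA a1E hcompBl hcomp1l hcompA.
  by rewrite opprB [X in X - _]addrC subrK subrr.
have [w [vw wv]] := hbij_inv (hsurj_hinj vs) vs.
have [h hE'] := eX (f \oA w \oA b1).
exists (h \oA a0 - f \oA w \oA s).
rewrite -[LHS]hcomp1r -wv hcompA hcompBr hcompBl !hcompA hE' -!hcompA a1E.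
by rewrite !hcompA.
Qed.

(** An extension of [d0' \oA f] lifts to [cpx0 X'], and what remains of [f] is killed by [d0'],
    hence factors through the differential of [X']. *)
Lemma orth_exts X X' M' (d0' : homA (cpx0 X') M') :
    projective_mod (cpx1 X) -> projective_mod (cpx0 X) -> minpres d0' ->
  exts X M' -> orth X X'.
Proof.
move=> X1p X0p mp' eX f; have [h hE'] := eX (d0' \oA f).
have [h' h'E] := proj_lift h X0p (mp_surj mp').
have [|s sE] := mp_lift (g := f - h' \oA cpxd X) mp' X1p.
  by rewrite hcompBr hE' hcompA h'E subrr.
by exists h', s; rewrite sE addrC subrK.
Qed.

Lemma minpres_proj M X (d0 : homA (cpx0 X) M) N : minpres d0 -> projective_mod M ->
  hdim (cpx0 X) N = hdim M N /\ hdim (cpx1 X) N = 0%N.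
Proof.
move=> mp Mp; have [s sE] := proj_lift (hid M) Mp (mp_surj mp).
have ss : s \oA d0 = hid _.
  apply/esym/subr0_eq/(superfluous_idem (mp_sup0 mp)).
    by rewrite hcompBr hcompA sE hcomp1l hcomp1r subrr.
  rewrite !(hcompBl, hcompBr) !hcomp1l hcomp1r -hcompA (hcompA d0) sE hcomp1l.
  by rewrite subrr subr0.
split.
  apply/esym/(@hdim_pre _ _ _ _ _ d0) => g => [gd|].
    by rewrite -[g]hcomp1r -sE hcompA gd hcomp0l.
  by exists (g \oA s); rewrite -hcompA ss hcomp1r.
have X10 : hid (cpx1 X) = 0.
  apply: superfluous_idem (mp_sup1 mp) _ (hcomp1l _).
  by rewrite hcomp1r -[LHS]hcomp1l -ss -hcompA (mp_comp0 mp) hcomp0r.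
apply/eqP; rewrite dimv_eq0 -subv0; apply/subvP=> g _.
by rewrite -[g]hcomp1r X10 hcomp0r mem0v.
Qed.

End TauRigid.

(** * The complexes attached to a tau-tilting pair *)

Section CVectors.
Variables (K : fieldType) (A : falgType K) (n : nat) (P : 'I_n -> rmodule A).
Implicit Types (M N Q : rmodule A) (X : cplx A).

Lemma direct_sum_summand (I : finType) (X : I -> rmodule A) M i :
  is_direct_sum M X -> exists (j : homA (X i) M) (r : homA M (X i)), r \oA j = hid _.
Proof.
case=> inj [prj [ipA pi _ _]]; have [iA pA] := ipA i.
exists (mkhom iA), (mkhom pA); apply: hom_ext => x.
by rewrite !hE !mkhomE -comp_lfunE pi id_lfunE.
Qed.

(** A summand of [M] gives its minimal presentation and a summand of [Q] the complex with that
    summand in degree 1 and zero in degree 0. The last clause says that the columns of [G] are the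
    classes of these complexes, tested by maps to [N]. *)
Lemma G_matrix_cplx M Q (G : 'M[int]_n) :
  tau_rigid_pair M Q -> is_G_matrix P M Q G ->
  exists X : 'I_n -> cplx A,
  [/\ forall j, projective_mod (cpx1 (X j)) /\ projective_mod (cpx0 (X j)),
      forall i j, orth (X i) (X j),
      forall j e1 e0, @ishom _ _ (X j) (X j) e1 e0 -> e1 \oA e1 = e1 -> e0 \oA e0 = e0 ->
        (e1 = 0 /\ e0 = 0) \/ (e1 = hid _ /\ e0 = hid _) &
      forall j N, (hdim (cpx0 (X j)) N)%:Z - (hdim (cpx1 (X j)) N)%:Z =
        \sum_l G l j * (hdim (P l) N)%:Z].
Proof.
move=> [Qp _ _ Mt QM] [k [Y [_ [MY Yi] [QY Y'i] gY]]].
have [P1 [P0 [d1 [d0 [/minpresP mpM extM]]]]] := tau_rigid_ext Mt.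
have gdim j g : is_g_vector P (Y j) g -> exists X (d : homA (cpx0 X) (Y j)),
    minpres d /\ forall N, (hdim (cpx0 X) N)%:Z - (hdim (cpx1 X) N)%:Z =
        \sum_l g l 0 * (hdim (P l) N)%:Z.
  case=> R1 [R0 [e1 [e0 [a [a' [mp Ra Ra' ->]]]]]].
  have [[_ e0A _ _] [_ e1A _ _]] := mp.
  exists (Cplx (mkhom e1A)), (mkhom e0A); split.
    by apply: minpresP; rewrite !vsprojK.
  move=> N /=; rewrite (hdim_mult _ Ra) (hdim_mult _ Ra') !(big_morph Posz PoszD (erefl 0%:Z)).
  by rewrite -sumrB; apply: eq_bigr => l _; rewrite !PoszM mxE mulrBl.
have extY X (i : 'I_n) : exts X M -> (i < k)%N -> exts X (Y i).
  move=> eX ik f; have [j [r rj]] := direct_sum_summand (Sub i ik) MY.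
  have [h jf] := eX (j \oA f).
  by exists (r \oA h); rewrite -hcompA -jf hcompA rj hcomp1l.
(* All that is needed about one complex is gathered here, so that [fin_all_exists] can choose the
   whole family; the last two clauses give orthogonality. *)
pose desc j (C : cplx A) :=
  [/\ projective_mod (cpx1 C) /\ projective_mod (cpx0 C),
      forall e1 e0, @ishom _ _ C C e1 e0 -> e1 \oA e1 = e1 -> e0 \oA e0 = e0 ->
        (e1 = 0 /\ e0 = 0) \/ (e1 = hid _ /\ e0 = hid _),
      forall N, (hdim (cpx0 C) N)%:Z - (hdim (cpx1 C) N)%:Z =
        \sum_l G l j * (hdim (P l) N)%:Z,
      hid (cpx0 C) = 0 \/ exists (i : 'I_n) (d : homA (cpx0 C) (Y i)), (i < k)%N /\ minpres d &
      forall i : 'I_n, (i < k)%N -> exts C (Y i)].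
have [j|X XP] := @fin_all_exists _ _ desc.
  have [jk|kj] := ltnP j k.
    have := gY j; rewrite jk => /gdim[C [d [mp dC]]]; exists C; split.
    - by split; [apply: mp_proj1 mp | apply: mp_proj0 mp].
    - by move=> e1 e0; apply: minpres_idem mp (Yi (Sub j jk)).
    - by move=> N; rewrite dC; apply: eq_bigr => l _; rewrite mxE.
    - by right; exists j, d.
    move=> i ik; apply: extY ik.
    have [j1 [r rj]] := direct_sum_summand (Sub j jk) MY.
    exact: (exts_summand mpM mp rj extM).
  have [j1 [r rj]] := direct_sum_summand (Sub j kj) QY.
  have Yp : projective_mod (Y j) := retract_proj rj Qp.
  have [Z Z0] := zero_mod_ex A; exists (@Cplx _ _ (Y j) Z 0); split=> /=.
  - by split=> //; apply: zero_mod_proj.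
  - move=> e1 e0 _ ee _; have e00 : e0 = 0 by rewrite -[e0]hcomp1l Z0 hcomp0l.
    by rewrite e00 Z0; case: (indec_idem (Y'i (Sub j kj)) ee) => ->; [left | right].
  (* The g-vector of the projective [Y j] is minus the column of [G], and the placement of [Y j] in
     degree 1 produces the matching sign. *)
  - move=> N; have := gY j; rewrite ltnNge kj => /gdim[C [d [mp dC]]].
    have [C0 C1] := minpres_proj N mp Yp; have := dC N; rewrite C0 C1 subr0 => ->.
    have -> : hdim Z N = 0%N.
      apply/eqP; rewrite dimv_eq0 -subv0; apply/subvP=> g _.
      by rewrite -[g]hcomp1r Z0 hcomp0r mem0v.
    by rewrite sub0r -sumrN; apply: eq_bigr => l _; rewrite !mxE mulNr opprK.
  - by left.
  (* The space of maps from [Q] to [M] is zero, hence so is that from its summand [Y j]. *)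
  move=> i ik; apply: extY ik => f; exists 0; rewrite hcomp0l.
  have f1 : f \oA r = 0.
    by apply: val_inj; apply/eqP; rewrite -memv0 -QM; apply: subvsP.
  by rewrite -[f]hcomp1r -rj hcompA f1 hcomp0l.
exists X; split=> [j|i j|j|j]; try by have [] := XP j.
have [[Xi1 Xi0] _ _ _ Xie] := XP i; have [_ _ _ [Xj0|[l [d [lk mp]]]] _] := XP j.
  by move=> f; exists 0, 0; rewrite hcomp0l hcomp0r addr0 -[f]hcomp1l Xj0 hcomp0l.
exact: orth_exts Xi1 Xi0 mp (Xie l lk).
Qed.

End CVectors.

(** * The brick attached to a c-vector *)

Theorem theorem1p3 (K : fieldType) (A : falgType K) (n : nat)
    (S P : 'I_n -> rmodule A)
    (hS : complete_simples S) (hP : projective_covers S P)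
    (c : 'cV[int]_n) (hc : c_vector P c) :
  exists (B : rmodule A) (b : 'cV[int]_n) (m : int),
    [/\ brick B, K0_class S B b, m != 0 & D_mx S *m b = m *: c].
Proof.
have [M [Q [G [C [j0 [[Mt _] GG CG ->]]]]]] := hc.
have [X [Xp Xo Xi XG]] := G_matrix_cplx Mt GG.
have [S1 _ _] := hS.
pose de l := hdim (S l) (S l).
have de0 l : (0 < de l)%N by apply: hdim_simple_gt0.
have CGE i j : \sum_l C l i * G l j = (i == j)%:R.
  have := congr1 (fun U : 'M[int]_n => U i j) CG; rewrite !mxE => <-.
  by apply: eq_bigr => l _; rewrite !mxE.
pose I := {j : 'I_n | j != j0}; pose XI (j : I) := X (val j).
have [B BX Bb] : exists2 B, perp XI B & brick B.
  apply: brick_exists => [N J e i WN es ii|].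
    by apply: perp_image WN es ii => j; have [] := Xp (val j).
  apply: NNPP => noB.
  have noperp N : perp XI N -> hid N = 0.
    by move=> WN; apply: NNPP => N0; apply: noB; exists N.
  (* This pairing with the column [j0] of [C] is normalised to take the value [C l j0] at [P l];
     dividing by the dimensions [de l] requires rational values. *)
  pose mu N : rat := \sum_l (C l j0)%:~R / (de l)%:R * (hdim N (S l))%:R.
  have mu_add M' M1 M2 (i1 : homA M1 M') (i2 : homA M2 M') p1 p2 :
      p1 \oA i1 = hid M1 -> p2 \oA i2 = hid M2 -> i1 \oA p1 + i2 \oA p2 = hid M' ->
      mu M' = mu M1 + mu M2.
    move=> pi1 pi2 ip; rewrite -big_split; apply: eq_bigr => l _ /=.
    by rewrite (hdim_add _ pi1 pi2 ip) natrD mulrDr.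
  have deK l (a : rat) : a / (de l)%:R * (de l)%:R = a.
    by rewrite divfK // pnatr_eq0 -lt0n.
  have muP l : mu (P l) = (C l j0)%:~R.
    rewrite /mu (bigD1 l) //= big1 => [|i il]; rewrite (hdim_PS hS hP) ?eqxx.
      by rewrite addr0 deK.
    by rewrite eq_sym (negPf il) mulr0.
  (* The difference of [mu] on the two terms is the product of the columns [j0] of [C] and [val j]
     of [G], which is zero. *)
  have Xg j : good mu (XI j).
    apply: (@good_indec _ _ _ mu mu_add); first exact: Xi.
    apply/subr0_eq; rewrite -sumrB.
    transitivity ((\sum_l C l j0 * G l (val j))%:~R : rat); last first.
      by rewrite CGE eq_sym (negPf (valP j)).
    rewrite rmorph_sum; apply: eq_bigr => l _ /=.
    rewrite -mulrBr.
    have -> : (hdim (cpx0 (XI j)) (S l))%:R - (hdim (cpx1 (XI j)) (S l))%:R =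
              ((G l (val j) * (de l)%:Z)%:~R : rat).
      rewrite !pmulrn -rmorphB /= XG (bigD1 l) //= big1 => [|i il].
        by rewrite (hdim_PS hS hP) eqxx addr0.
      by rewrite (hdim_PS hS hP) (negPf il) mulr0.
    by rewrite !rmorphM /= mulrCA mulrC -pmulrn deK.
  (* If [perp XI] had only zero objects, [mu] would vanish on projectives and the column [j0] of [C]
     would be zero, against [CGE j0 j0]. *)
  have C0 l : C l j0 = 0.
    apply/eqP; rewrite -(intr_eq0 rat) -muP; apply/eqP.
    apply: (@mu_proj _ _ _ XI _ _ noperp _ mu (P l) mu_add Xg); last exact: (@covers_proj _ _ _ _ _ hP).
      by move=> j; apply: Xp.
    by move=> i j; apply: Xo.
  have := CGE j0 j0; rewrite eqxx big1 => [/eqP|l _]; last by rewrite C0 mul0r.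
  by rewrite eq_sym oner_eq0.
have [b bB] := K0_exists hS B; have [_ b0] := K0_class_ge0 bB.
have DE l : (D_mx S *m b) l 0 = (de l)%:Z * b l 0.
  by rewrite mul_diag_mx !mxE -hdimE.
pose v := D_mx S *m b; pose m := (G^T *m v) j0 0.
(* For [j] other than [j0], the entry is the difference of the dimensions of the maps to [B] from
   the two terms of [X j], which agree as [B] satisfies [perp XI]. *)
have Gv : G^T *m v = m *: delta_mx j0 0.
  apply/colP => j; rewrite [RHS]mxE [delta_mx _ _ _ _]mxE eqxx andbT.
  have [->|jj0] := eqVneq j j0; first by rewrite mulr1.
  rewrite mulr0 mxE; transitivity (\sum_l G l j * (hdim (P l) B)%:Z).
    by apply: eq_bigr => l _; rewrite mxE DE (hdim_PK0 hS hP _ bB).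
  rewrite -XG; have [B1 B2] := BX (Sub j jj0).
  by rewrite [hdim (cpx0 _) _](@hdim_pre _ _ _ _ _ (cpxd (X j)) B1 B2) subrr.
have GC : C *m G^T = 1%:M.
  by apply: mulmx1C; rewrite -[C]trmxK -trmx_mul CG trmx1.
have vE : v = m *: col j0 C.
  by rewrite -[LHS]mul1mx -GC -mulmxA Gv -scalemxAr -colE.
(* If [m] were zero, so would be [v] and, the [de l] being positive, [b]; but the class of a nonzero
   module is nonzero. *)
exists B, b, m; split=> //; apply/eqP => m0; apply: b0; first by case: Bb.
apply/colP => l; rewrite [RHS]mxE; apply/eqP.
have := DE l; rewrite -/v vE m0 scale0r mxE => /esym/eqP.
by rewrite mulf_eq0 => /orP[|//]; rewrite eqz_nat -leqn0 leqNgt de0.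
Qed.
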